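(* Let $p$ be an odd prime, $H\cong\mathbb{Z}_p^5$, and $A\le\mathrm{Aut}(H)$ a $p$-group such that the set $C_H(A)$ of elements of $H$ fixed by all elements of $A$ satisfies $|C_H(A)|\ge p^2$. Let $\mathcal A=V(H,A)$. If $\mathcal A$ is indecomposable, then $\mathcal A$ is a CI-S-ring.
   Context: $H$ is written additively; $\mathrm{Aut}(H)\le\mathrm{Sym}(H)$. $\mathrm{Cay}(H,S)$ is the digraph on $H$ with arcs $(x,x+s)$, $s\in S$. An S-ring over $H$ is a subalgebra $\mathcal A\subseteq\mathbb{Q}H$ spanned by $\underline{T}=\sum_{t\in T}t$ for $T$ in a partition $\mathrm{Bs}(\mathcal A)$ of $H$ (basic sets) with $\{0\}\in\mathrm{Bs}(\mathcal A)$ and $-T\in\mathrm{Bs}(\mathcal A)$ for all $T$. $V(H,A)$ is the S-ring whose basic sets are the $A$-orbits on $H$. A subgroup $K\le H$ is an $\mathcal A$-subgroup if $\underline K\in\mathcal A$; $\mathrm{rad}(S)=\{h\in H:h+S=S\}$. If $F\le E$ are $\mathcal A$-subgroups with $F\le\mathrm{rad}(T)$ for every basic set $T\subseteq H\setminus E$, $\mathcal A$ is an $E/F$-wreath product; $\mathcal A$ is decomposable if it is an $E/F$-wreath product with $E\ne H$, $F\ne\{0\}$, and indecomposable otherwise. $\mathrm{Aut}(\mathcal A)=\bigcap_{T\in\mathrm{Bs}(\mathcal A)}\mathrm{Aut}(\mathrm{Cay}(H,T))$. $\mathrm{Iso}(\mathcal A)$ is the set of bijections $f:H\to H$ such that $\{\mathrm{Cay}(H,T)^f:T\in\mathrm{Bs}(\mathcal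 A)\}=\{\mathrm{Cay}(H,S):S\in\mathrm{Bs}(\mathcal B)\}$ for some S-ring $\mathcal B$ over $H$; $\mathcal A$ is a CI-S-ring if $\mathrm{Iso}(\mathcal A)=\mathrm{Aut}(\mathcal A)\mathrm{Aut}(H)$. *)

(* Defs.v *)
From HB Require Import structures.
From mathcomp Require Import all_boot all_order all_algebra all_fingroup.
Set Implicit Arguments. Unset Strict Implicit. Unset Printing Implicit Defensive.
Import GRing.Theory.
Local Open Scope ring_scope.

Section SRings.
Variable H : finZmodType.

Definition AutH : {set {perm H}} :=
  [set f : {perm H} | [forall x, forall y, f (x + y) == f x + f y]].

Definition CH (A : {set {perm H}}) : {set H} :=
  [set x | [forall a in A, a x == x]].

Definition orbA (A : {set {perm H}}) (x : H) : {set H} := [set (a : {perm H}) x | a in A].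
Definition Vorb (A : {set {perm H}}) : {set {set H}} := [set orbA A x | x in H].

(* An S-ring over H, given by its set of basic sets P. The Q-span of the
   sums of the blocks of a partition P consists of the elements of QH whose
   coefficients are constant on each block; so closure under multiplication
   means: for basic sets T1, T2 the coefficient of x in T1*T2, i.e. the
   number of (t1,t2) in T1 x T2 with t1 + t2 = x, is constant on each T. *)
Definition mulcoef (T1 T2 : {set H}) (x : H) : nat :=
  #|[set t : H * H | [&& t.1 \in T1, t.2 \in T2 & t.1 + t.2 == x]]|.

Definition is_Sring (P : {set {set H}}) : Prop :=
  [/\ partition P [set: H],
      [set 0 : H] \in P,
      (forall T, T \in P -> [set - x | x in T] \in P) &
      (forall T1 T2 T, T1 \in P -> T2 \in P -> T \in P ->
         forall x y, x \in T -> y \in T -> mulcoef T1 T2 x = mulcoef T1 T2 y)].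

Definition cay (S : {set H}) : {set H * H} := [set xy | xy.2 - xy.1 \in S].

Definition dimg (f : {perm H}) (D : {set H * H}) : {set H * H} :=
  [set (f xy.1, f xy.2) | xy in D].

Definition AutS (P : {set {set H}}) : {set {perm H}} :=
  [set f : {perm H} | [forall T in P, dimg f (cay T) == cay T]].

Definition IsoS (P : {set {set H}}) (f : {perm H}) : Prop :=
  exists Q : {set {set H}}, is_Sring Q /\
    [set dimg f (cay T) | T in P] = [set cay S | S in Q].

(* CI-S-ring: Iso(A) = Aut(A) Aut(H) (product of sets in the group {perm H};
   (a * s) x = s (a x), i.e. a is applied first). *)
Definition CI_Sring (P : {set {set H}}) : Prop :=
  forall f : {perm H}, IsoS P f <-> f \in (AutS P * AutH)%g.

Definition is_subgrp (K : {set H}) : bool :=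
  (0 \in K) && [forall x in K, forall y in K, x - y \in K].

(* underline K lies in the span of the basic sets iff K is a union of
   basic sets. *)
Definition Asubgroup (P : {set {set H}}) (K : {set H}) : bool :=
  is_subgrp K && [forall T in P, (T \subset K) || [disjoint T & K]].

Definition rad (S : {set H}) : {set H} := [set h | [set h + s | s in S] == S].

Definition wreath (P : {set {set H}}) (E F : {set H}) : bool :=
  [&& Asubgroup P E, Asubgroup P F, F \subset E &
      [forall T in P, (T \subset ~: E) ==> (F \subset rad T)]].

Definition decomposable (P : {set {set H}}) : bool :=
  [exists E : {set H}, exists F : {set H},
     [&& wreath P E F, E != [set: H] & F != [set 0]]].

End SRings.

(* Main.v *)
Require Import Defs.
From mathcomp Require Import all_boot all_order all_algebra all_fingroup all_solvable.
Set Implicit Arguments. Unset Strict Implicit. Unset Printing Implicit Defensive.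
Import GRing.Theory.
Local Open Scope ring_scope.

(* Let U = C_H(A) and let W x be the group of those u in U for which x + u lies in
   the orbit xA.  Indecomposability means that, for each u <> 0 in U, the x with
   u \notin W x generate H.  After a translation, an isomorphism f of the S-ring
   fixes 0 and satisfies f (x + y) \in f y + f (xA); it then suffices to find an
   additive bijection L with L x \in f (xA) for all x.

   If f is additive modulo U, the second difference of f along x and z takes its
   values in f (W x :&: W z).  Successive differences along directions that avoid
   a given u shrink this group, so f has constant second differences, and
   subtracting from f half of its second difference along (x, x), which lies in
   f (W x), leaves an additive map.

   To see that f is additive modulo U, let U1 / U be the group of fixed points of
   A on H / U.
   - If U1 has index p, let B be the group of displacements modulo U of a point
     outside U1.  Then f is additive along B, which forces the elements of A that
     f induces outside U1 to centralise B, and this makes them trivial modulo U.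
   - If |U1| = p^3 and A centralises H / U1, then e |-> a e - e, for e in U1 \ U,
     embeds A / C_A(H / U) in U.  The defect of additivity of f along e is an
     additive map with values T x in W x; as W x is a line for three pairwise
     independent x, this forces T = 0.
   - If |U1| = p^3 and A does not centralise H / U1, let M be the hyperplane of
     points fixed modulo U1.  Outside M, either no orbit meets a coset of U1 in
     more than a coset of U, or the orbits are transitive modulo U and every W x
     is trivial; both cases are again settled by second differences. *)

(** * Identities in abelian groups *)

(* A reflexive decision procedure for identities in abelian groups: both sides
   are compared through the integer coefficients of their atoms. *)
Inductive zexpr :=
  | ZVar of nat | ZZero | ZAdd of zexpr & zexpr | ZOpp of zexpr
  | ZMuln of zexpr & nat.

Fixpoint zcoef (e : zexpr) (i : nat) : int :=
  match e with
  | ZVar n => if (n == i)%N then 1 else 0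
  | ZZero => 0
  | ZAdd e1 e2 => zcoef e1 i + zcoef e2 i
  | ZOpp e1 => - zcoef e1 i
  | ZMuln e1 n => zcoef e1 i *+ n
  end.

Section ZEval.
Variable V : zmodType.

Fixpoint zeval (env : seq V) (e : zexpr) : V :=
  match e with
  | ZVar n => nth 0 env n
  | ZZero => 0
  | ZAdd e1 e2 => zeval env e1 + zeval env e2
  | ZOpp e1 => - zeval env e1
  | ZMuln e1 n => zeval env e1 *+ n
  end.

Lemma zeval_coef env e :
  zeval env e = \sum_(i < size env) nth 0 env i *~ zcoef e i.
Proof.
elim: e => [n||e1 IH1 e2 IH2|e1 IH1|e1 IH1 n] /=; rewrite ?IH1 ?IH2.
- case: (ltnP n (size env)) => [ltn|len].
    rewrite (bigD1 (Ordinal ltn)) //= eqxx mulr1z big1 ?addr0 // => i.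
    by rewrite -val_eqE eq_sym /= => /negPf->; rewrite mulr0z.
  rewrite nth_default // big1 // => i _.
  by rewrite gtn_eqF ?mulr0z // (leq_trans _ len).
- by rewrite big1 // => i _; rewrite mulr0z.
- by rewrite -big_split; apply: eq_bigr => i _; rewrite mulrzDr.
- by rewrite -sumrN; apply: eq_bigr => i _; rewrite mulrNz.
- rewrite -sumrMnl; apply: eq_bigr => i _.
  by rewrite -[in RHS]mulr_natr mulrzA mulrz_nat.
Qed.

Lemma zeval_eq env e1 e2 :
  all (fun i => zcoef e1 i == zcoef e2 i) (iota 0 (size env)) ->
  zeval env e1 = zeval env e2.
Proof.
move=> /allP eq12; rewrite !zeval_coef; apply: eq_bigr => i _.
by move/(_ (i : nat)): eq12; rewrite mem_iota ltn_ord => /(_ isT) /eqP ->.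
Qed.

End ZEval.

(* Atoms are compared up to conversion, since rewriting may leave different
   paths to the same algebraic structure in the goal. *)
Ltac zsame x y :=
  match constr:(true) with
  | _ => let _ := match constr:(true) with _ => unify x y end in constr:(true)
  | _ => constr:(false)
  end.

Ltac zindex x env :=
  lazymatch env with
  | ?y :: ?env' =>
      lazymatch zsame x y with
      | true => constr:(0%N)
      | false => let n := zindex x env' in constr:(S n)
      end
  end.

Ltac zmember x env :=
  lazymatch env with
  | ?y :: ?env' =>
      lazymatch zsame x y with
      | true => constr:(true)
      | false => zmember x env'
      end
  | _ => constr:(false)
  end.

Ltac zatoms t env :=
  lazymatch t with
  | ?x + ?y => let env1 := zatoms x env in zatoms y env1
  | - ?x => zatoms x env
  | 0 => env
  | ?x *+ S _ => zatoms x env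
  | ?x *+ O => zatoms x env
  | _ => lazymatch zmember t env with
         | true => env
         | false => constr:(t :: env)
         end
  end.

Ltac zreify t env :=
  lazymatch t with
  | ?x + ?y =>
      let e1 := zreify x env in let e2 := zreify y env in constr:(ZAdd e1 e2)
  | - ?x => let e1 := zreify x env in constr:(ZOpp e1)
  | 0 => constr:(ZZero)
  | ?x *+ (S ?n) => let e1 := zreify x env in constr:(ZMuln e1 (S n))
  | ?x *+ O => let e1 := zreify x env in constr:(ZMuln e1 O)
  | _ => let n := zindex t env in constr:(ZVar n)
  end.

Ltac abel :=
  lazymatch goal with
  | |- @eq ?T ?l ?r =>
      let env0 := zatoms l (@nil T) in
      let env := zatoms r env0 in
      let e1 := zreify l env in
      let e2 := zreify r env in
      exact: (@zeval_eq _ env e1 e2 isT)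
  end.

(** * Subgroups of elementary abelian groups *)

Section Subgroups.
Variables (H : finZmodType) (p : nat).
Hypotheses (p_pr : prime p) (expH : forall x : H, x *+ p = 0).
Implicit Types (E G : {group H}) (x y z : H).

Lemma grp0 G : 0 \in G. Proof. exact: (group1 G). Qed.
Lemma grpD G x y : x \in G -> y \in G -> x + y \in G.
Proof. exact: groupM. Qed.
Lemma grpN G x : x \in G -> - x \in G.
Proof. by move=> xG; have := groupVr xG. Qed.
Lemma grpB G x y : x \in G -> y \in G -> x - y \in G.
Proof. by move=> xG yG; apply: grpD => //; apply: grpN. Qed.
Lemma grpMn G x n : x \in G -> x *+ n \in G.
Proof. by move=> xG; have := groupX n xG; rewrite FinRing.Theory.zmodXgE. Qed.

Lemma grpDr G x y : x \in G -> (y + x \in G) = (y \in G).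
Proof.
move=> xG; apply/idP/idP => h; last exact: grpD.
by rewrite -(addrK x y); apply: grpB.
Qed.

Lemma add_group_set (S : {set H}) :
  0 \in S -> {in S &, forall x y, x + y \in S} -> group_set S.
Proof. by move=> S0 SD; apply/group_setP; split. Qed.

Lemma between_prime E G E' :
  E \subset G -> G \subset E' -> #|E'| = (p * #|E|)%N ->
  G = E :> {set H} \/ G = E' :> {set H}.
Proof.
move=> sEG sGE' cE'.
have /dvdnP[m cG] := cardSg sEG.
have := cardSg sGE'; rewrite cG cE' dvdn_pmul2r ?cardG_gt0 // => mp.
have [m1|/eqP mp'] : m = 1%N \/ m == p.
  by have [_ /(_ _ mp) /orP[/eqP|]] := primeP p_pr; [left|right].
- by left; apply/eqP; rewrite eq_sym eqEcard sEG cG m1 mul1n leqnn.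
- by right; apply/eqP; rewrite eqEcard sGE' cG mp' cE' leqnn.
Qed.

Lemma mem_cycle_join E x y :
  y \in (<[x]> <*> E)%g -> exists k, y - x *+ k \in E.
Proof.
have ab : (<[x]> \subset 'C(E))%g.
  exact: subset_trans (subsetT _)
    (subset_trans (FinRing.Theory.zmod_abelian [set: H]) (centS (subsetT E))).
rewrite cent_joinEl // => /mulsgP[_ e /cycleP[k ->] eE ->].
by by exists k; rewrite FinRing.Theory.zmodXgE FinRing.Theory.zmodMgE addrAC subrr add0r.
Qed.

Lemma span_prime E E' x y :
  E \subset E' -> #|E'| = (p * #|E|)%N -> x \in E' -> x \notin E ->
  y \in E' -> exists k, y - x *+ k \in E.
Proof.
move=> sEE' cE' xE' xE yE'; apply: mem_cycle_join.
have sEG := joing_subr <[x]>%g E.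
have sGE' : (<[x]> <*> E \subset E')%g by rewrite join_subG cycle_subG xE'.
have [eqE|->//] := between_prime sEG sGE' cE'.
by rewrite -eqE mem_gen // inE cycle_id in xE.
Qed.

Lemma muln_inverse k : ~~ (p %| k)%N -> exists k', forall x, x *+ k *+ k' = x.
Proof.
rewrite -prime_coprime // coprime_sym => cop.
have k_gt0 : (0 < k)%N.
  by case: k cop => //; rewrite /coprime gcd0n (gtn_eqF (prime_gt1 p_pr)).
have [u v e _] := egcdnP p k_gt0; exists u => x.
rewrite -mulrnA mulnC e (eqP cop) mulrnDr mulnC mulrnA expH mul0rn add0r.
by rewrite mulr1n.
Qed.

Lemma span_prime_unit E E' x y :
  E \subset E' -> #|E'| = (p * #|E|)%N -> x \in E' -> x \notin E ->
  y \in E' -> y \notin E ->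
  exists k k', (forall z, z *+ k *+ k' = z) /\ y - x *+ k \in E.
Proof.
move=> sEE' cE' xE' xE yE' yE.
have [k yk] := span_prime sEE' cE' xE' xE yE'.
have pk : ~~ (p %| k)%N.
  apply: contra yE => /dvdnP[m km].
  by rewrite km mulnC mulrnA expH mul0rn subr0 in yk.
by have [k' kk'] := muln_inverse pk; exists k, k'.
Qed.

Lemma grp_half (p_odd : odd p) x G : x + x \in G -> x \in G.
Proof.
have /muln_inverse[k kk] : ~~ (p %| 2)%N.
  by rewrite dvdn_prime2 //; apply: contraL p_odd => /eqP->.
by move=> xG; rewrite -(kk x) mulr2n grpMn.
Qed.

End Subgroups.

Ltac ingrp := repeat first
  [ solve [auto 4] | apply: grpMn | apply: grpB | apply: grpD | apply: grpN | exact: grp0 ].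

(* [inlin t] proves a membership in a subgroup by rewriting the element as the
   combination [t] of known members. *)
Ltac inlin t :=
  lazymatch goal with
  | |- is_true (?s \in ?G) =>
      let e := fresh in
      have e : s = t;
        [by abel | refine (@eq_ind_r _ t (fun z => is_true (z \in G)) _ s e); ingrp]
  end.

(** * Orbits and fixed points *)

Section Orbits.
Variable H : finZmodType.
Implicit Types (A : {group {perm H}}) (s : {perm H}) (x y : H).

Lemma autHP s : reflect (forall x y, s (x + y) = s x + s y) (s \in AutH H).
Proof.
rewrite inE; apply: (iffP forallP) => [h x y|h x]; first by have /forallP/(_ y)/eqP := h x.
by apply/forallP => y; apply/eqP.
Qed.

Lemma basic_setP A x y : reflect (exists2 a, a \in A & y = a x) (y \in Defs.orbA A x).
Proof. exact: imsetP. Qed.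

Lemma mem_basic_set A x : x \in Defs.orbA A x.
Proof. by apply/basic_setP; exists 1%g; rewrite ?group1 ?perm1. Qed.

End Orbits.

(** * Fixed points, radicals and invariant subgroups *)

Section Action.
Variables (H : finZmodType) (p : nat) (A : {group {perm H}}).
Hypotheses (p_pr : prime p) (p_odd : odd p) (expH : forall x : H, x *+ p = 0).
Hypotheses (autA : A \subset AutH H) (pA : (p.-group A)%g).
Implicit Types (E G : {group H}) (a c : {perm H}) (x y z m n u v b : H).

Lemma actD a x y : a \in A -> a (x + y) = a x + a y.
Proof. by move=> aA; apply: (autHP _ (subsetP autA a aA)). Qed.

Lemma act0 a : a \in A -> a 0 = 0.
Proof. by move=> aA; apply: (addIr (a 0)); rewrite -actD // !add0r. Qed.

Lemma actN a x : a \in A -> a (- x) = - a x.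
Proof. by move=> aA; apply: (addIr (a x)); rewrite -actD // !addNr act0. Qed.

Lemma actMn a x k : a \in A -> a (x *+ k) = a x *+ k.
Proof.
move=> aA; elim: k => [|k IH]; first by rewrite !mulr0n act0.
by rewrite !mulrS actD // IH.
Qed.

Definition actE a (aA : a \in A) :=
  (fun x y => @actD a x y aA, fun x => @actN a x aA, act0 aA).

Definition invariant (S : {set H}) := forall a x, a \in A -> x \in S -> a x \in S.

Lemma fixP x : reflect (forall a, a \in A -> a x = x) (x \in CH A).
Proof.
rewrite inE; apply: (iffP forallP) => [h a aA|h a].
  by apply/eqP; have := h a; rewrite aA.
by apply/implyP => aA; apply/eqP; apply: h.
Qed.

Lemma fix_group_set : group_set (CH A).
Proof.
apply: add_group_set => [|x y /fixP xU /fixP yU].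
  by apply/fixP => a; apply: act0.
by apply/fixP => a aA; rewrite (actE aA) xU // yU.
Qed.
Canonical fix_group := Group fix_group_set.
Local Notation U := fix_group.

Lemma fixE a u : a \in A -> u \in U -> a u = u.
Proof. by move=> aA /fixP; apply. Qed.

Lemma fix_invariant : invariant U.
Proof. by move=> a x aA xU; rewrite fixE. Qed.

(* The part of the radical of the basic set of x that is fixed by A. *)
Definition fixrad x : {set H} := [set u in CH A | [exists a in A, a x == x + u]].
Local Notation W := fixrad.

Lemma fixradP x u :
  reflect (u \in U /\ exists2 a, a \in A & a x = x + u) (u \in W x).
Proof.
apply: (iffP idP) => [|[uU [a aA e]]].
  by rewrite in_set => /andP[uU /exists_inP[a aA /eqP e]]; split=> //; exists a.
by rewrite in_set uU; apply/exists_inP; exists a => //; apply/eqP.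
Qed.

(** The displacements are fixed by [A], so composing two elements of [A] adds them. *)
Lemma fixrad_group_set x : group_set (W x).
Proof.
apply: add_group_set => [|u v /fixradP[uU [a aA au]] /fixradP[vU [b bA bv]]].
  apply/fixradP; split; first exact: grp0.
  by exists 1%g; rewrite ?group1 // perm1 addr0.
apply/fixradP; split; first exact: grpD.
exists (a * b)%g; first exact: groupM.
by rewrite permM au (actE bA) bv (fixE bA uU); abel.
Qed.
Canonical fixrad_group x := Group (fixrad_group_set x).

Lemma fixrad_sub x : W x \subset U.
Proof. by apply/subsetP => u /fixradP[]. Qed.

Lemma fixrad_act a x : a \in A -> W (a x) = W x.
Proof.
move=> aA.
have sub (b : {perm H}) y : b \in A -> W y \subset W (b y).
  move=> bA; apply/subsetP => u /fixradP[uU [c cA cu]]; apply/fixradP; split=> //.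
  exists (b^-1 * c * b)%g; first by rewrite !groupM ?groupV.
  by rewrite !permM permK cu (actE bA) (fixE bA uU).
apply/eqP; rewrite eqEsubset sub // andbT.
by rewrite -{2}(permK a x) sub ?groupV.
Qed.

Lemma fixrad_addU x v : v \in U -> W (x + v) = W x.
Proof.
move=> vU.
have sub y w : w \in U -> W y \subset W (y + w).
  move=> wU; apply/subsetP => u /fixradP[uU [c cA cu]]; apply/fixradP; split=> //.
  by exists c => //; rewrite (actE cA) cu (fixE cA wU); abel.
by apply/eqP; rewrite eqEsubset sub // andbT -{2}(addrK v x) sub // grpN.
Qed.

(** The main tool for showing [W] constant on a coset: the orbit of [x] need only meet each coset of
    [U] in it. *)
Lemma fixrad_cong a x y : a \in A -> y - a x \in U -> W y = W x.
Proof.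
move=> aA yU; rewrite -(fixrad_act x aA) -(fixrad_addU (a x) yU).
by congr fixrad; abel.
Qed.

Lemma fixrad_muln k k' x : (forall z, z *+ k *+ k' = z) -> W (x *+ k) = W x.
Proof.
move=> kk'.
have sub y l u : u \in W y -> u *+ l \in W (y *+ l).
  move=> /fixradP[uU [c cA cu]]; apply/fixradP; split; first exact: grpMn.
  by exists c => //; rewrite actMn // cu mulrnDl.
apply/eqP; rewrite eqEsubset; apply/andP; split; apply/subsetP => u uW.
  by rewrite -(kk' u) mulrnAC; apply: (grpMn (G := fixrad_group x)); rewrite -{1}(kk' x); apply: sub.
rewrite -(kk' u); apply: (grpMn (G := fixrad_group _)); exact: sub.
Qed.

(** For an invariant subgroup [S], the preimage of the fixed points of [A] on [H / S]; [cen U] is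
    the [U1] of the overview. *)
Definition cen (S : {set H}) : {set H} := [set m | [forall a in A, a m - m \in S]].

Lemma cenP (S : {set H}) m : reflect (forall a, a \in A -> a m - m \in S) (m \in cen S).
Proof. by rewrite inE; apply: (iffP forall_inP). Qed.

Lemma cen_group_set E : group_set (cen E).
Proof.
apply: add_group_set => [|x y /cenP xE /cenP yE]; apply/cenP => a aA.
  by rewrite (actE aA) subrr grp0.
rewrite (actE aA); have -> : a x + a y - (x + y) = (a x - x) + (a y - y) by abel.
by rewrite grpD ?xE ?yE.
Qed.
Canonical cen_group E := Group (cen_group_set E).

Lemma cen_invariant E : invariant E -> invariant (cen E).
Proof.
move=> iE a x aA /cenP xE; apply/cenP => b bA.
have -> : b (a x) - a x = (b x - x) + b (a x - x) - (a x - x) by rewrite !(actE bA); abel.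
by ingrp.
Qed.

Lemma sub_cen E : invariant E -> E \subset cen E.
Proof. by move=> iE; apply/subsetP => x xE; apply/cenP => a aA; rewrite grpB ?iE. Qed.

Lemma act_coset E a x : invariant E -> a \in A ->
  ('P^*)%act (E :* x)%g a = (E :* a x)%g.
Proof.
move=> iE aA; apply/setP => y; apply/imsetP/rcosetP => [[_ /rcosetP[e eE ->] ->]|[e eE ->]].
  by exists (a e); [apply: iE|apply: actD].
exists ((a^-1%g) e + x); last by rewrite /= /aperm actD // permKV.
by apply/rcosetP; exists ((a^-1%g) e); rewrite ?iE ?groupV.
Qed.

(** [A] permutes the cosets of [E], a positive power of [p] in number; the number of fixed ones is
    divisible by [p], and [E] is one of them. *)
Lemma cen_proper k E : #|H| = (p ^ k)%N -> invariant E -> E != [set: H] :> {set H} ->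
  exists2 x, x \in cen E & x \notin E.
Proof.
move=> cH iE neE.
pose S := rcosets E [set: H].
have actsS : [acts A, on S | 'P^*].
  apply/subsetP => a aA; rewrite inE inE; apply/andP; split=> //.
  apply/subsetP => _ /rcosetsP[x _ ->]; rewrite inE; have := act_coset x iE aA; rewrite /= => ->.
  by apply/rcosetsP; exists (a x).
have := pgroup_fix_mod pA actsS.
have [j _ cS] : exists2 j, (j <= k)%N & #|S| = (p ^ j)%N.
  by apply/(dvdn_pfactor _ _ p_pr); rewrite -cH -cardsT dvdn_indexg.
have S_gt1 : (1 < #|S|)%N by rewrite indexg_gt1 subTset.
rewrite cS; case: j cS => [|j] cS; first by rewrite cS in S_gt1.
rewrite expnS modnMr => /esym fix0.
have ES : (E : {set H}) \in 'Fix_(S | 'P^*)(A)%g.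
  rewrite inE; apply/andP; split; first by apply/rcosetsP; exists 0; rewrite // rcoset1.
  apply/afixP => a aA; have := act_coset 0 iE aA.
  by rewrite act0 // -[0]/(1%g) !rcoset1.
have [T TS neT] : exists2 T, T \in 'Fix_(S | 'P^*)(A)%g & T != E.
  apply/exists_inP; apply: contraLR (introT eqP fix0) => /exists_inPn all_E.
  have -> : 'Fix_(S | 'P^*)(A)%g = [set (E : {set H})].
    apply/setP => T; rewrite in_set1; apply/idP/eqP => [/all_E|->//].
    by rewrite negbK => /eqP.
  by rewrite cards1 modn_small ?prime_gt1.
move: TS neT; rewrite inE => /andP[/rcosetsP[x _ ->] /afixP fixT] neT.
exists x; last by apply: contra neT => xE; rewrite rcoset_id.
apply/cenP => a aA; have := fixT a aA; rewrite act_coset // => e.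
have : a x \in (E :* x)%g by rewrite -e rcoset_refl.
by case/rcosetP=> e' e'E ->; rewrite FinRing.Theory.zmodMgE addrK.
Qed.


(** * Indecomposability *)

Section Indecomposable.
Hypothesis indec : ~~ decomposable (Vorb A).

Lemma invariant_Asubgroup E : invariant E -> Asubgroup (Vorb A) E.
Proof.
move=> iE; apply/andP; split.
  apply/andP; split; first exact: grp0.
  by apply/forall_inP => x xE; apply/forall_inP => y yE; apply: grpB.
apply/forall_inP => _ /imsetP[x _ ->]; case: (boolP (x \in E)) => xE; apply/orP.
  by left; apply/subsetP => _ /basic_setP[a aA ->]; apply: iE.
right; rewrite disjoint_subset; apply/subsetP => _ /basic_setP[a aA ->].
by rewrite inE; apply: contra xE => /(iE _ _ (groupVr aA)); rewrite permK.
Qed.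

(** If [F] is the group of all [v] in [U] lying in [W x] for every [x] outside [E], the S-ring is an
    [E/F]-wreath product. Indecomposability enters only through this. *)
Lemma fixrad_separate E u : invariant E -> E != [set: H] :> {set H} -> u \in U ->
  (forall x, x \notin E -> u \in W x) -> u = 0.
Proof.
move=> iE neE uU uW; apply: contraNeq indec => u0.
pose F : {set H} := [set v in CH A | [forall (x | x \notin E), v \in W x]].
have FP v : reflect (v \in U /\ forall x, x \notin E -> v \in W x) (v \in F).
  apply: (iffP idP) => [|[vU vW]]; rewrite in_set.
    by case/andP => vU /forall_inP.
  by rewrite vU; apply/forall_inP.
have gF : group_set F.
  apply: add_group_set => [|v w /FP[vU vW] /FP[wU wW]]; apply/FP; split.
  - exact: grp0.
  - by move=> x _; exact: (grp0 (fixrad_group x)).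
  - exact: grpD.
  - by move=> x xE; exact: (grpD (G := fixrad_group x) (vW x xE) (wW x xE)).
have iF : invariant F by move=> a v aA /[dup] vF /FP[vU _]; rewrite fixE.
apply/existsP; exists (E : {set H}); apply/existsP; exists F.
apply/and3P; split=> //; last first.
  by apply: contraNneq u0 => F0; rewrite -in_set1 -F0; apply/FP.
rewrite /wreath invariant_Asubgroup // (@invariant_Asubgroup (Group gF)) //=.
apply/andP; split.
  (* [F] lies in [E]: for [v] in [F] outside [E], some [a] sends [v] to [v + v], yet fixes [v]; so
     [v = 0]. *)
  apply/subsetP => v /FP[vU vW]; apply: contraT => /[dup] vE /vW /fixradP[_ [a aA]].
  rewrite fixE // => e; have v0 : v = 0 by apply: (addrI v); rewrite -e addr0.
  by rewrite v0 grp0 in vE.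
apply/forall_inP => _ /imsetP[x _ ->]; apply/implyP => /subsetP/(_ _ (mem_basic_set A x)).
rewrite inE => xE; apply/subsetP => v /FP[vU /(_ _ xE) vW]; rewrite inE eqEcard (card_imset _ (@addrI _ v)) leqnn andbT.
apply/subsetP => _ /imsetP[_ /basic_setP[a aA ->] ->]; apply/basic_setP.
case/fixradP: vW => _ [b bA e]; exists (b * a)%g; first exact: groupM.
by rewrite permM e (actE aA) (fixE aA vU) addrC.
Qed.

(* The largest invariant subgroup of [G] contains every [x] with [u \notin W x],
   so the S-ring decomposes unless [G] is everything. *)
Lemma fixrad_span G u : u \in U -> u != 0 ->
  (forall x, u \notin W x -> x \in G) -> forall x, x \in G.
Proof.
move=> uU u0 uG.
pose E : {set H} := [set x | [forall a in A, a x \in G]].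
have EP x : reflect (forall a, a \in A -> a x \in G) (x \in E).
  by rewrite inE; apply: (iffP forall_inP).
have gE : group_set E.
  apply: add_group_set => [|x y /EP xE /EP yE]; apply/EP => a aA.
    by rewrite (actE aA) grp0.
  by rewrite (actE aA) grpD ?xE ?yE.
have iE : invariant E.
  move=> a x aA /EP xE; apply/EP => b bA.
  by have := xE _ (groupM aA bA); rewrite permM.
have ET : E = [set: H].
  apply/eqP; apply: contraNT u0 => neE.
  apply/eqP; apply: (@fixrad_separate (Group gE)) => // x xE.
  apply: contraNT xE => uW; apply/EP => a aA; apply: uG.
  by rewrite fixrad_act.
by move=> x; have := in_setT x; rewrite -ET => /EP/(_ 1%g (group1 A)); rewrite perm1.
Qed.

(** * Additivity modulo an invariant subgroup *)

Section Isomorphism.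
Variable f : {perm H}.
Hypothesis f0 : f 0 = 0.
Hypothesis fA : forall x y, exists2 a, a \in A & f (x + y) = f y + f (a x).

Lemma im_sub_if E x y : invariant E -> x - y \in E -> f x - f y \in f @: E.
Proof.
move=> iE xyE; have [a aA] := fA (x - y) y; rewrite subrK => ->.
by rewrite addrC addKr imset_f ?iE.
Qed.

Lemma im_coset E y : invariant E -> [set f (y + m) - f y | m in E] = f @: E.
Proof.
move=> iE; apply/eqP; rewrite eqEcard; apply/andP; split.
  apply/subsetP => _ /imsetP[m mE ->]; apply: im_sub_if => //.
  by rewrite addrC addKr.
rewrite !card_imset ?leqnn //; first by move=> m n /addIr/perm_inj/addrI.
exact: perm_inj.
Qed.

Lemma im_group_set E : invariant E -> group_set (f @: E).
Proof.
move=> iE; apply: add_group_set => [|_ _ /imsetP[m mE ->] /imsetP[n nE ->]].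
  by apply/imsetP; exists 0; rewrite ?grp0.
have : f n \in [set f (m + n') - f m | n' in E] by rewrite im_coset ?imset_f.
by case/imsetP=> n' n'E ->; rewrite addrC subrK imset_f ?grpD.
Qed.
Definition im_group E (iE : invariant E) := Group (im_group_set iE).

Lemma im_sub E x y : invariant E -> (f x - f y \in f @: E) = (x - y \in E).
Proof.
move=> iE; apply/idP/idP; last exact: im_sub_if.
rewrite -(im_coset y iE) => /imsetP[m mE] /addIr /perm_inj ->.
by rewrite addrC addKr.
Qed.

Lemma im_mem (S : {set H}) x : (f x \in f @: S) = (x \in S).
Proof. by rewrite mem_imset //; apply: perm_inj. Qed.

Definition addset : {set H} := [set m | [forall y, f (y + m) == f y + f m]].

Lemma addsetP m : reflect (forall y, f (y + m) = f y + f m) (m \in addset).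
Proof. by rewrite inE; apply: (iffP forallP) => h y; apply/eqP; apply: h. Qed.

Lemma addset_group_set : group_set addset.
Proof.
apply: add_group_set => [|m n /addsetP mK /addsetP nK]; apply/addsetP => y.
  by rewrite f0 !addr0.
by rewrite addrA (nK (y + m)) (mK y) (nK m) addrA.
Qed.
Canonical addset_group := Group addset_group_set.

Definition addmod (S : {set H}) : {set H} :=
  [set m | [forall y, f (y + m) - f y - f m \in f @: S]].

Lemma addmodP (S : {set H}) m :
  reflect (forall y, f (y + m) - f y - f m \in f @: S) (m \in addmod S).
Proof. by rewrite inE; apply: forallP. Qed.

Lemma addmod_group_set E : invariant E -> group_set (addmod E).
Proof.
move=> iE; pose F := im_group iE.
apply: add_group_set => [|m n /addmodP mK /addmodP nK]; apply/addmodP => y.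
  by rewrite f0 addr0 !subrr; exact: (grp0 F).
have mK' z : f (z + m) - f z - f m \in F := mK z.
have nK' z : f (z + n) - f z - f n \in F := nK z.
suff : f (y + (m + n)) - f y - f (m + n) \in F by [].
rewrite addrA.
inlin ((f (y + m + n) - f (y + m) - f n) + (f (y + m) - f y - f m)
       - (f (m + n) - f m - f n)).
Qed.
Definition addmod_group E (iE : invariant E) := Group (addmod_group_set iE).

(** By [fA], [f (m + y) = f y + f (a m)], and [a m] is congruent to [m] modulo [E]. *)
Lemma cen_addmod E : invariant E -> cen E \subset addmod E.
Proof.
move=> iE; apply/subsetP => m /cenP mE; apply/addmodP => y.
have [a aA] := fA m y; rewrite [y + m]addrC => ->.
by rewrite [f y + _]addrC addrK im_sub //; apply: mE.
Qed.

Lemma fix_addset : U \subset addset.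
Proof.
apply/subsetP => u uU; apply/addsetP => y.
by have [a aA] := fA u y; rewrite [y + u]addrC => ->; rewrite (fixE aA uU).
Qed.

Lemma im_addU u y : u \in U -> f (y + u) = f y + f u.
Proof. by move=> uU; have /addsetP := subsetP fix_addset _ uU; apply. Qed.

Lemma im_fixrad_group_set x : group_set (f @: W x).
Proof.
apply: add_group_set => [|_ _ /imsetP[m mE ->] /imsetP[n nE ->]].
  by apply/imsetP; exists 0; rewrite ?(grp0 (fixrad_group x)).
have nU := subsetP (fixrad_sub x) _ nE.
by rewrite -im_addU // imset_f // (grpD (G := fixrad_group x)).
Qed.
Canonical im_fixrad_group x := Group (im_fixrad_group_set x).

Definition diff2 x z y := f (y + z + x) - f (y + z) - f (y + x) + f y.

Lemma diff2C x z y : diff2 x z y = diff2 z x y.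
Proof. by rewrite /diff2 [y + z + x]addrAC; abel. Qed.

(* Both [f (y + x + z) - f (y + x)] and [f (y + z) - f y] lie in the image of the
   basic set of [z]; modulo [f @: U] they agree, so their difference lies in
   [f @: W z]. *)
Lemma diff2_fixrad x z y : x \in addmod U -> diff2 x z y \in f @: W z.
Proof.
move=> /addmodP xK; pose F := im_group fix_invariant.
have xK' w : f (w + x) - f w - f x \in F := xK w.
have [a aA ea] := fA z (y + x); have [b bA eb] := fA z y.
have e : diff2 x z y = f (a z) - f (b z).
  rewrite /diff2; have -> : y + z + x = z + (y + x) by abel.
  by rewrite ea [y + z]addrC eb; abel.
have uU : a z - b z \in U.
  rewrite -(im_sub _ _ fix_invariant) -e; suff : diff2 x z y \in F by [].
  by rewrite /diff2; inlin ((f (y + z + x) - f (y + z) - f x) - (f (y + x) - f y - f x)).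
have eu : a z = b z + (a z - b z) by abel.
rewrite e {1}eu im_addU // addrC addKr im_mem -(fixrad_act z bA); apply/fixradP.
split=> //; exists (b^-1 * a)%g; first by rewrite groupM ?groupV.
by rewrite permM permK.
Qed.

(** The [a] given by [fA] moves [m] by an element of [U], hence of [W m], along which [f] is
    additive; this sharpens [cen_addmod]. *)
Lemma cen_fixrad m y : m \in cen U -> f (y + m) - f y - f m \in f @: W m.
Proof.
move=> /cenP mU; have [a aA ea] := fA m y.
have uU := mU a aA; have em : a m = m + (a m - m) by abel.
have -> : f (y + m) - f y - f m = f (a m - m).
  by rewrite addrC [y + m]addrC ea em im_addU // -em; abel.
by rewrite im_mem; apply/fixradP; split=> //; exists a.
Qed.

(** * Second differences *)

Hypothesis pH : (p.-group [set: H])%g.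
Local Notation lg G := (logn p #|G|).

Lemma card_lg G : #|G| = (p ^ lg G)%N.
Proof. exact: card_pgroup (pgroupS (subsetT G) pH). Qed.

Lemma lg_sub E G : E \subset G -> (lg E <= lg G)%N.
Proof. by move/cardSg => d; apply: dvdn_leq_log. Qed.

Lemma lg_proper E G : E \proper G -> (lg E < lg G)%N.
Proof.
by move/proper_card; rewrite {1}(card_lg E) {1}(card_lg G) ltn_exp2l ?prime_gt1.
Qed.

Lemma lg0 G x : lg G = 0%N -> x \in G -> x = 0.
Proof.
move=> G0; have := card_lg G; rewrite G0 expn0 => /eqP; rewrite -trivg_card1.
by move=> /eqP -> /set1gP.
Qed.

Lemma nontriv G : (0 < lg G)%N -> exists2 u, u \in G & u != 0.
Proof.
move=> G0; apply/exists_inP; apply: contraLR G0 => /exists_inPn all0.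
rewrite -eqn0Ngt; have -> : (G : {set H}) = 1%g; last by rewrite cards1 logn1.
apply/trivgP/subsetP => x /all0; rewrite negbK => /eqP->; exact: set11.
Qed.

Lemma cap_prime E G u : (lg E <= 1)%N -> u \in E -> u \notin G ->
  forall v, v \in E -> v \in G -> v = 0.
Proof.
move=> E1 uE uG v vE vG; apply: (@lg0 (E :&: G)%G); last by rewrite inE vE.
have prEG : (E :&: G)%G \proper E.
  rewrite properE subsetIl; apply: contra uG => /subsetP/(_ u uE).
  by rewrite inE => /andP[].
by apply/eqP; rewrite -leqn0 -ltnS (leq_trans (lg_proper prEG)).
Qed.

Lemma period_group_set (h : H -> H) : group_set [set z | [forall y, h (y + z) == h y]].
Proof.
apply: add_group_set => [|z z']; rewrite inE.
  by apply/forallP => y; rewrite addr0.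
move=> /forallP zh /[!inE] /forallP zh'; apply/forallP => y.
by rewrite addrA (eqP (zh' _)).
Qed.

(** Take [u != 0] in [S]. If [u] is not in [W z], then [S] meets [W z] trivially and [z] is a period
    of [h]. Such [z] generate [H] by [fixrad_span], and the periods form a group. *)
Lemma const_of_prime (S : {group H}) (h : H -> H) : S \subset U -> (lg S <= 1)%N ->
  (forall z y, h (y + z) - h y \in f @: W z) ->
  (forall z y, h (y + z) - h y \in f @: S) ->
  forall z y, h (y + z) = h y.
Proof.
move=> SU S1 hW hS.
have fin z y s : h (y + z) - h y = f s -> s = 0 -> h (y + z) = h y.
  by move=> e s0; apply/eqP; rewrite -subr_eq0 e s0 f0.
have [S0|S_gt0] := posnP (lg S).
  by move=> z y; have /imsetP[s /(lg0 S0)] := hS z y => s0 e; apply: fin e s0.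
have [u uS u0] := nontriv S_gt0.
suff : forall z, z \in Group (period_group_set h).
  by move=> hz z y; have := hz z; rewrite inE => /forallP/(_ y)/eqP.
apply: (@fixrad_span _ u) => //; first exact: subsetP SU _ uS.
move=> z uz; rewrite inE; apply/forallP => y; apply/eqP.
have /imsetP[s sS e] := hS z y; have := hW z y; rewrite e im_mem => sW.
by apply: fin e _; apply: (cap_prime (G := fixrad_group z) S1 uS uz).
Qed.

Definition affine (h : H -> H) := forall z y, h (y + z) - h y = h z - h 0.

(** Fix [u != 0] in [S]. Along a [z] with [u] outside [W z], the difference of [h] takes its values
    in the image of [S :&: W z], of order at most [p], so [const_of_prime] makes it constant. Such
    [z] generate [H]. *)
Lemma affine_of_lg2 (S : {group H}) (h : H -> H) : S \subset U -> (lg S <= 2)%N ->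
  (forall z y, h (y + z) - h y \in f @: W z) ->
  (forall z y, h (y + z) - h y \in f @: S) ->
  affine h.
Proof.
move=> SU S2 hW hS.
have [S1|S_gt1] := leqP (lg S) 1.
  by move=> z y; have c := const_of_prime SU S1 hW hS; rewrite c -[z]add0r c !subrr.
have [u uS u0] := nontriv (ltnW S_gt1).
have gG : group_set [set z | [forall y, h (y + z) - h y == h z - h 0]].
  apply: add_group_set => [|z z']; rewrite inE.
    by apply/forallP => y; rewrite addr0 !subrr.
  move=> /forallP zh /[!inE] /forallP zh'; apply/forallP => y; apply/eqP.
  have /eqP e1 := zh' (y + z); have /eqP e2 := zh y; have /eqP e3 := zh' z.
  rewrite addrA; have -> : h (y + z + z') - h y = (h (y + z + z') - h (y + z)) + (h (y + z) - h y) by abel.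
  rewrite e1 e2; have -> : h (z + z') - h 0 = (h (z + z') - h z) + (h z - h 0) by abel.
  by rewrite e3.
suff hz : forall z, z \in Group gG.
  by move=> z y; have := hz z; rewrite inE => /forallP/(_ y)/eqP.
apply: (@fixrad_span _ u) => //; first exact: subsetP SU _ uS.
move=> z uz; rewrite inE; apply/forallP => y; apply/eqP.
pose S' := (S :&: fixrad_group z)%G.
have S'S : S' \proper S.
  rewrite properE subsetIl; apply: contra uz => /subsetP/(_ u uS).
  by rewrite inE => /andP[].
have S'1 : (lg S' <= 1)%N by rewrite -ltnS (leq_trans (lg_proper S'S)).
have S'U : S' \subset U by apply: subset_trans SU; apply: subsetIl.
pose h' y := h (y + z) - h y.
have imI s : s \in f @: W z -> s \in f @: S -> s \in f @: S'.
  by move=> /imsetP[t tW ->]; rewrite !im_mem inE => ->.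
have dW w y' : h' (y' + w) - h' y' \in im_fixrad_group w.
  have e1 : h (y' + z + w) - h (y' + z) \in im_fixrad_group w := hW w _.
  have e2 : h (y' + w) - h y' \in im_fixrad_group w := hW w _.
  rewrite /h' [y' + w + z]addrAC.
  inlin ((h (y' + z + w) - h (y' + z)) - (h (y' + w) - h y')).
have dS w y' : h' (y' + w) - h' y' \in f @: S'.
  have gS' : group_set (f @: S').
    apply: add_group_set => [|_ _ /imsetP[m mS ->] /imsetP[n nS ->]].
      by apply/imsetP; exists 0; rewrite ?(grp0 S').
    by rewrite -im_addU ?(subsetP S'U) // imset_f // grpD.
  have e y1 : h' y1 \in Group gS' by apply: imI; [apply: hW|apply: hS].
  by apply: (grpB (G := Group gS')).
have c := const_of_prime S'U S'1 dW dS.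
by rewrite -/(h' y) -[y]add0r c /h' add0r.
Qed.

Lemma affine_diff_group_set :
  group_set [set x | [forall z, [forall y,
    diff2 x z y == diff2 x z 0]]].
Proof.
apply: add_group_set => [|x x']; rewrite inE.
  by apply/forallP=> z; apply/forallP => y; rewrite /diff2 !addr0; apply/eqP; abel.
move=> /forallP hx /[!inE] /forallP hx'; apply/forallP => z; apply/forallP => y.
have e w : diff2 (x + x') z w = diff2 x z (w + x') + diff2 x' z w.
  rewrite /diff2; have -> : w + z + (x + x') = w + x' + z + x by abel.
  have -> : w + (x + x') = w + x' + x by abel.
  have -> : w + x' + z = w + z + x' by abel.
  by abel.
have /forallP hxz := hx z; have /forallP hxz' := hx' z.
by rewrite !e (eqP (hxz _)) (eqP (hxz (0 + x'))) (eqP (hxz' y)).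
Qed.

Lemma addmod_affine : (lg U <= 3)%N -> (forall m, m \in addmod U) ->
  forall x z y, diff2 x z y = diff2 x z 0.
Proof.
move=> U3 allK.
have small x : (lg (fixrad_group x) <= 2)%N -> forall z y, diff2 x z y = diff2 x z 0.
  move=> x2 z y.
  have e w v : diff2 x w v = f (v + w + x) - f (v + w) - (f (v + x) - f v).
    by rewrite /diff2; abel.
  (* The differences of this function along [w] are second differences of [f]; by symmetry they lie
     in both [f @: W w] and [f @: W x]. *)
  have aff : affine (fun y => f (y + x) - f y).
    apply: (@affine_of_lg2 (fixrad_group x)) (fixrad_sub x) x2 _ _ => w v.
      by rewrite -e; apply: diff2_fixrad.
    by rewrite -e diff2C; apply: diff2_fixrad.
  by rewrite !e !(aff z).
have [U2|U_gt2] := leqP (lg U) 2.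
  by move=> x; apply: small; rewrite (leq_trans _ U2) // lg_sub ?fixrad_sub.
have [u uU u0] := nontriv (ltnW (ltnW U_gt2)).
suff hx : forall x, x \in Group affine_diff_group_set.
  by move=> x z y; have := hx x; rewrite inE => /forallP/(_ z)/forallP/(_ y)/eqP.
(* If [u] is outside [W x], then [W x] is proper in [U], hence of order at most [p ^ 2]. *)
apply: (@fixrad_span _ u) => // x ux; rewrite inE.
apply/forallP => z; apply/forallP => y; apply/eqP; apply: small.
rewrite -ltnS (leq_trans _ U3) // lg_proper // properE fixrad_sub.
by apply: contra ux => /subsetP; apply.
Qed.

(* If the second differences of [f] are constant, [f] differs from an additive
   map by the quadratic map [x |-> diff2 x x 0 / 2], with values in [f @: W x]. *)
Lemma additive_representative : (forall m, m \in addmod U) ->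
  (forall x z y, diff2 x z y = diff2 x z 0) ->
  exists2 L : {perm H}, L \in AutH H & forall x, exists2 a, a \in A & L x = f (a x).
Proof.
move=> allK aff.
have p2 : ~~ (p %| 2)%N by rewrite dvdn_prime2 //; apply: contraL p_odd => /eqP->.
have [k half2] := muln_inverse p_pr expH p2.
pose L x := f x - diff2 x x 0 *+ k.
have diff2D x x' z : diff2 (x + x') z 0 = diff2 x z 0 + diff2 x' z 0.
  rewrite -(aff x z x') /diff2 !add0r [x' + z + x]addrAC [x' + x]addrC.
  have -> : z + (x + x') = x + x' + z by abel.
  by rewrite [z + x']addrC f0; abel.
have diff2Dr x z z' : diff2 x (z + z') 0 = diff2 x z 0 + diff2 x z' 0.
  by rewrite ![diff2 x _ _]diff2C diff2D.
have LD x y : L (x + y) = L x + L y.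
  rewrite /L !diff2D !diff2Dr (diff2C y x).
  have -> : f (x + y) = f x + f y + diff2 x y 0.
    by rewrite /diff2 f0 !add0r [y + x]addrC; abel.
  have -> : (diff2 x x 0 + diff2 x y 0 + (diff2 x y 0 + diff2 y y 0)) *+ k
     = diff2 x x 0 *+ k + diff2 x y 0 *+ 2 *+ k + diff2 y y 0 *+ k.
    by rewrite !mulrnDl; abel.
  by rewrite half2; abel.
have LA x : exists2 a, a \in A & L x = f (a x).
  have : diff2 x x 0 *+ k \in im_fixrad_group x.
    by apply: grpMn; apply: diff2_fixrad.
  case/imsetP => w wW e; rewrite /L e.
  have [wU _] := fixradP _ _ wW.
  have /fixradP[_ [a aA ea]] : - w \in W x by apply: (grpN (G := fixrad_group x)).
  exists a => //; rewrite ea im_addU ?grpN //; congr (_ + _).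
  by apply: (addIr (f w)); rewrite -im_addU // !addNr f0.
have L0 : L 0 = 0 by apply: (addIr (L 0)); rewrite -LD !add0r.
have LN x : L (- x) = - L x by apply: (addIr (L x)); rewrite -LD !addNr.
have Linj : injective L.
  move=> x y /eqP; rewrite -subr_eq0 -LN -LD => /eqP e.
  have [a aA ea] := LA (x - y); apply/eqP; rewrite -subr_eq0 -(inj_eq (@perm_inj _ a)) act0 //.
  by rewrite -(inj_eq (@perm_inj _ f)) -ea e f0.
exists (perm Linj) => [|x]; last by rewrite permE; apply: LA.
by rewrite inE; apply/forallP => x; apply/forallP => y; rewrite !permE LD.
Qed.

Lemma actX_mod E a x d k : invariant E -> a \in A -> a x - x - d \in E ->
  a d - d \in E -> (a ^+ k)%g x - x - d *+ k \in E.
Proof.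
move=> iE aA xd dE; elim: k => [|k IH].
  by rewrite expg0 perm1 mulr0n subr0 subrr grp0.
rewrite expgSr permM mulrSr.
have e1 := iE a _ aA IH; rewrite !(actE aA) actMn // in e1.
have e2 : (a d - d) *+ k \in E by apply: grpMn.
rewrite mulrnBl in e2.
inlin ((a ((a ^+ k)%g x) - a x - a d *+ k) + (a x - x - d) + (a d *+ k - d *+ k)).
Qed.

Lemma lg_cycle_sub (S : {group H}) u : S \subset (<[u : H]>)%g -> (lg S <= 1)%N.
Proof.
move=> sSu; suff : (#|S| %| p ^ 1)%N by rewrite {1}(card_lg S) dvdn_Pexp2l ?prime_gt1.
rewrite expn1; apply: dvdn_trans (cardSg sSu) _.
by rewrite -orderE order_dvdn FinRing.Theory.zmodXgE expH.
Qed.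

(** By [cen_fixrad] the difference of [f] along [m] stays in one coset of [f @: W m], of order at
    most [p]; [const_of_prime] makes it constant, with value [f m] at [0]. *)
Lemma additive_of_small_fixrad m : m \in cen U -> (lg (fixrad_group m) <= 1)%N ->
  m \in addset.
Proof.
move=> mM m1; have mK := subsetP (cen_addmod fix_invariant) m mM.
pose h y := f (y + m) - f y.
have e z y : h (y + z) - h y = diff2 m z y by rewrite /h /diff2; abel.
have hc z y : h (y + z) = h y.
  apply: (@const_of_prime (fixrad_group m)) (fixrad_sub m) m1 _ _ z y => z y.
    by rewrite e; apply: diff2_fixrad.
  have h1 : h (y + z) - f m \in im_fixrad_group m by apply: cen_fixrad.
  have h2 : h y - f m \in im_fixrad_group m by apply: cen_fixrad.
  suff : h (y + z) - h y \in im_fixrad_group m by [].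
  inlin ((h (y + z) - f m) - (h y - f m)).
apply/addsetP => y; have := hc y 0; rewrite /h !add0r f0 subr0 => <-.
by abel.
Qed.

(** * Invariant hyperplanes *)

Section Hyperplane.
Variable M : {group H}.
Hypotheses (iM : invariant M) (cardM : #|[set: H]| = (p * #|M|)%N).

Lemma notin_hyperplane : exists x, x \notin M.
Proof.
apply/existsP; apply: contraT; rewrite negb_exists => /forallP all_in.
have /eqP : #|[set: H]| = #|M|.
  by apply: eq_card => x; rewrite inE; have := all_in x; rewrite negbK => ->.
by rewrite cardM -[X in _ == X]mul1n eqn_pmul2r ?cardG_gt0 // gtn_eqF ?prime_gt1.
Qed.

Lemma hyperplane_span x y : x \notin M -> exists k, y - x *+ k \in M.
Proof.
by move=> xM; apply: (@span_prime _ _ p_pr M [set: H]%G) => //; rewrite ?subsetT ?inE.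
Qed.

Lemma hyperplane_span_unit x y : x \notin M -> y \notin M ->
  exists k k', (forall z : H, z *+ k *+ k' = z) /\ y - x *+ k \in M.
Proof.
move=> xM yM.
exact: (@span_prime_unit _ _ p_pr expH M [set: H]%G x y
  (subsetT _) cardM (in_setT _) xM (in_setT _) yM).
Qed.

Lemma hyperplane_full (G : {group H}) x : M \subset G -> x \in G -> x \notin M ->
  forall y, y \in G.
Proof.
move=> sMG xG xM y; have [k yk] := hyperplane_span y xM.
have yG := subsetP sMG _ yk.
inlin (y - x *+ k + x *+ k).
Qed.

(** [cen M] contains [M] and, by [cen_proper], a point outside it, so it is all of [H]. *)
Lemma hyperplane_act a x : a \in A -> a x - x \in M.
Proof.
move=> aA.
have neM : M != [set: H] :> {set H}.
  have [y yM] := notin_hyperplane; apply: contraNneq yM => ->; exact: in_setT.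
have [k cH] : exists k, #|H| = (p ^ k)%N.
  by exists (lg [set: H]%G); rewrite -cardsT -card_lg.
have [y yc yM] := cen_proper cH iM neM.
by have /cenP := hyperplane_full (G := cen_group M) (sub_cen iM) yc yM x; apply.
Qed.

(** An element [z] of [M] is the sum of [x] and [z - x], both outside [M]. *)
Lemma hyperplane_const (F : {group H}) (h : H -> H) :
  (forall z y, z \notin M -> h (y + z) - h y \in F) ->
  forall z y, h (y + z) - h y \in F.
Proof.
move=> hF z y; have [zM|] := boolP (z \in M); last exact: hF.
have [x xM] := notin_hyperplane.
have zxM : z - x \notin M.
  by apply: contra xM => zxM; inlin (z - (z - x)).
have := hF _ (y + x) zxM; have := hF _ y xM.
have -> : y + x + (z - x) = y + z by abel.
move=> h1 h2; inlin ((h (y + z) - h (y + x)) + (h (y + x) - h y)).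
Qed.

(** Every point outside [M] is an invertible multiple of a point of [x + M], and such multiples have
    the same [W]. *)
Lemma hyperplane_fixrad x u : x \notin M -> u \in U ->
  (forall m, m \in M -> u \in W (x + m)) -> u = 0.
Proof.
move=> xM uU uW; apply: (@fixrad_separate M) => //.
  have [y yM] := notin_hyperplane; apply: contraNneq yM => ->; exact: in_setT.
move=> y yM; have [k [k' [kk' yk]]] := hyperplane_span_unit xM yM.
have -> : y = (x + (y - x *+ k) *+ k') *+ k by rewrite mulrnDl mulrnAC kk'; abel.
by rewrite (fixrad_muln _ kk') uW // grpMn.
Qed.

(** Second differences along [m] and a [z] outside [M] lie in [f @: W z], which is trivial;
    [hyperplane_const] extends the vanishing to all [z]. *)
Lemma hyperplane_additive m : (forall x, x \notin M -> forall u, u \in W x -> u = 0) ->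
  m \in addmod U -> m \in addset.
Proof.
move=> W0 mK; pose h y := f (y + m) - f y.
have hc z y : h (y + z) - h y \in 1%G.
  apply: hyperplane_const => {}z {}y zM; rewrite /h.
  have := diff2_fixrad z y mK; case/imsetP => u /(W0 _ zM) ->; rewrite f0 => e.
  by rewrite inE; apply/eqP; rewrite -[RHS]/(0 : H) -e /diff2; abel.
apply/addsetP => y; have := hc y 0; rewrite inE => /eqP; rewrite /h !add0r f0 subr0.
by move/eqP; rewrite -[1%g]/(0 : H) subr_eq0 => /eqP <-; abel.
Qed.

End Hyperplane.

(** * Fixed points modulo U forming a hyperplane *)

Section HyperplaneCase.
Local Notation M := (cen_group U).
Hypothesis cardM : #|[set: H]| = (p * #|M|)%N.
Hypothesis lgM : (lg M <= lg U + 2)%N.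
Let iM : invariant M := cen_invariant fix_invariant.

Let MU a m : a \in A -> m \in M -> a m - m \in U.
Proof. by move=> aA /cenP; apply. Qed.

Let UM u : u \in U -> u \in M.
Proof. exact: (subsetP (sub_cen fix_invariant)). Qed.

Lemma trivial_mod_fix a x : a \in A -> x \notin M -> a x - x \in U ->
  forall y, a y - y \in U.
Proof.
move=> aA xM xU y; have [k yk] := hyperplane_span cardM y xM.
have := MU aA yk; rewrite !(actE aA) actMn // => h.
have : (a x - x) *+ k \in U by apply: grpMn.
rewrite mulrnBl => h'.
inlin ((a y - a x *+ k - (y - x *+ k)) + (a x *+ k - x *+ k)).
Qed.

Variable x0 : H.
Hypothesis x0M : x0 \notin M.

(** The group [B] of the overview, for the base point [x0]; here [M] is [U1]. *)
Definition shift : {set H} := [set b | [exists a in A, a x0 - x0 - b \in U]].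

Lemma shiftP b : reflect (exists2 a, a \in A & a x0 - x0 - b \in U) (b \in shift).
Proof. by rewrite inE; apply: exists_inP. Qed.

Lemma shift_sub : shift \subset M.
Proof.
apply/subsetP => b /shiftP[a aA ab].
have h := hyperplane_act iM cardM x0 aA; have bU := UM ab.
inlin ((a x0 - x0) - (a x0 - x0 - b)).
Qed.

Lemma shift_group_set : group_set shift.
Proof.
apply: add_group_set => [|b b' bB b'B].
  by apply/shiftP; exists 1%g; rewrite ?group1 // perm1 subr0 subrr grp0.
have := subsetP shift_sub _ bB.
case/shiftP: bB => a aA ab; case/shiftP: b'B => a' a'A a'b bM.
apply/shiftP; exists (a * a')%g; first exact: groupM.
rewrite permM; have h1 := fix_invariant a'A ab; have h2 := MU a'A bM.
rewrite !(actE a'A) in h1.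
inlin ((a' (a x0) - a' x0 - a' b) + (a' x0 - x0 - b') + (a' b - b)).
Qed.
Canonical shift_group := Group shift_group_set.
Local Notation B := shift_group.

Lemma fix_sub_shift : U \subset B.
Proof.
apply/subsetP => u uU; apply/shiftP; exists 1%g; first exact: group1.
by rewrite perm1 subrr sub0r grpN.
Qed.

Lemma act_shift a : a \in A -> a x0 - x0 \in B.
Proof. by move=> aA; apply/shiftP; exists a => //; rewrite subrr grp0. Qed.

(** [B] does not depend on the base point: modulo [M], [x] is an invertible multiple of [x0], and
    [A] fixes [M] modulo [U]. *)
Lemma shift_act x b : x \notin M -> b \in B -> exists2 a, a \in A & a x - x - b \in U.
Proof.
move=> xM bB; have [k [k' [kk' xk]]] := hyperplane_span_unit cardM x0M xM.
have /shiftP[a aA ab] : b *+ k' \in B by apply: grpMn.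
exists a => //; have := MU aA xk; rewrite !(actE aA) actMn // => h1.
have : (a x0 - x0 - b *+ k') *+ k \in U by apply: grpMn.
rewrite !mulrnBl mulrnAC kk' => h2.
inlin ((a x - a x0 *+ k - (x - x0 *+ k)) + (a x0 *+ k - x0 *+ k - b)).
Qed.

Lemma fixrad_shift x b : x \notin M -> b \in B -> W (x + b) = W x.
Proof.
move=> xM bB; have [a aA ab] := shift_act xM bB.
by apply: (fixrad_cong aA); inlin (- (a x - x - b)).
Qed.

(** For every [m] in [M], the displacements by [a] of [x0 + m] and [x0 + m + b] both lie in
    [W (x0 + m)]. Their difference [a b - b] therefore lies in all these groups and vanishes. *)
Lemma trivial_act_shift a b : a \in A -> (forall y, a y - y \in U) -> b \in B ->
  a b = b.
Proof.
move=> aA aU bB; apply/eqP; rewrite -subr_eq0; apply/eqP.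
apply: (hyperplane_fixrad iM cardM x0M (aU b)) => m mM.
have xM : x0 + m \notin M by rewrite grpDr.
have h1 : a (x0 + m) - (x0 + m) \in fixrad_group (x0 + m).
  by apply/fixradP; split=> //; exists a => //; abel.
have h2 : a (x0 + m + b) - (x0 + m + b) \in fixrad_group (x0 + m).
  rewrite /= -(fixrad_shift xM bB).
  by apply/fixradP; split=> //; exists a => //; abel.
suff : a b - b \in fixrad_group (x0 + m) by [].
have -> : a b - b = (a (x0 + m + b) - (x0 + m + b)) - (a (x0 + m) - (x0 + m)).
  by rewrite !(actE aA); abel.
exact: grpB.
Qed.

Lemma lg_shift : (lg U < lg B)%N.
Proof.
apply: lg_proper; rewrite properE fix_sub_shift; apply: contra x0M => /subsetP BU.
by apply/cenP => a aA; apply: BU; apply: act_shift.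
Qed.

(** When [B / U] has order [p], each [a] agrees at [x0] modulo [U] with a power of [a0]; the two
    differ by an element trivial modulo [U], which fixes [b]. So the orbit of [b] lies in [b +
    <[a0 b - b]>]. *)
Lemma lg_fixrad_shift b : lg B = (lg U).+1 -> b \in B -> (lg (fixrad_group b) <= 1)%N.
Proof.
move=> lgB bB; have bM := subsetP shift_sub _ bB.
have [a0 a0A d0U] : exists2 a, a \in A & a x0 - x0 \notin U.
  have : x0 \notin cen U by [].
  by rewrite inE negb_forall => /existsP[a]; rewrite negb_imply => /andP[]; exists a.
apply: (@lg_cycle_sub _ (a0 b - b)); apply/subsetP => u /fixradP[uU [a aA ea]].
have cardB : #|B| = (p * #|U|)%N by rewrite (card_lg B) lgB expnS -card_lg.
have [k ak] := span_prime p_pr fix_sub_shift cardB (act_shift a0A) d0U (act_shift aA).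
have dM := subsetP shift_sub _ (act_shift a0A).
have a0k : (a0 ^+ k)%g \in A by apply: groupX.
have d00 : a0 x0 - x0 - (a0 x0 - x0) \in U by rewrite subrr grp0.
have h0 := actX_mod k fix_invariant a0A d00 (MU a0A dM).
pose c := (a * (a0 ^+ k)^-1)%g.
have cA : c \in A by rewrite groupM ?groupV.
have cx0 : c x0 - x0 \in U.
  rewrite /c permM; have h1 : a x0 - (a0 ^+ k)%g x0 \in U.
    by inlin ((a x0 - x0 - (a0 x0 - x0) *+ k) - ((a0 ^+ k)%g x0 - x0 - (a0 x0 - x0) *+ k)).
  have := fix_invariant (groupVr a0k) h1.
  by rewrite !(actE (groupVr a0k)) permK.
have cb := trivial_act_shift cA (trivial_mod_fix cA x0M cx0) bB.
have ab : a b = (a0 ^+ k)%g b by rewrite -{2}cb /c permM permKV.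
have a0b : (a0 ^+ k)%g b = b + (a0 b - b) *+ k.
  have i1 : invariant 1%G by move=> a' x a'A /set1gP ->; rewrite -[1%g]/(0 : H) act0 // grp0.
  have := @actX_mod 1%G a0 b (a0 b - b) k i1 a0A.
  rewrite subrr (fixE a0A (MU a0A bM)) subrr => /(_ (grp0 _) (grp0 _)) /set1gP.
  by move/eqP; rewrite -[1%g]/(0 : H) -addrA -opprD subr_eq0 => /eqP.
by apply/cycleP; exists k; rewrite FinRing.Theory.zmodXgE; apply: (addrI b); rewrite -ea ab.
Qed.

(** As [M / U] has order at most [p ^ 2], either [B = M], and [W] is constant on [x + M], hence
    trivial outside [M]; or [B / U] has order [p], and [W b] is small. *)
Lemma shift_additive b : b \in B -> b \in addset.
Proof.
move=> bB; have bM := subsetP shift_sub _ bB.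
have [lgB|lgB] : lg B = lg M \/ lg B = (lg U).+1.
  have := lg_sub shift_sub; have := lg_shift; rewrite leq_eqVlt => h1.
  rewrite leq_eqVlt => /orP[/eqP|h2]; [by left|right].
  apply/eqP; rewrite eq_sym; case/orP: h1 => // h1; exfalso.
  have := leq_ltn_trans h1 (leq_trans h2 lgM).
  by rewrite addn2 ltnn.
- have BM : B = M :> {set H}.
    by apply/eqP; rewrite eqEcard shift_sub /= (card_lg B) (card_lg M) lgB leqnn.
  apply: (hyperplane_additive cardM) => [x xM u uW|].
    apply: (hyperplane_fixrad iM cardM xM (subsetP (fixrad_sub x) _ uW)) => m mM.
    by rewrite fixrad_shift // -[_ \in _]/(m \in (B : {set H})) BM.
  exact: subsetP (cen_addmod fix_invariant) _ bM.
- by apply: additive_of_small_fixrad bM _; apply: lg_fixrad_shift.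
Qed.

(** Additivity along [b] gives [a' (x + b) = a x + b] for the [a'] induced at [x + b]. So [a x] and
    [a' x] differ by [a' b - b], which lies in [W x], and [a b = a' b]. *)
Lemma shift_commute x y a b : x \notin M -> a \in A -> f (x + y) = f y + f (a x) ->
  b \in B -> a b - b \in W x.
Proof.
move=> xM aA e bB; have /addsetP bK := shift_additive bB.
have bM := subsetP shift_sub _ bB.
have [a' a'A e'] := fA (x + b) y.
have e1 : a' (x + b) = a x + b.
  apply: (@perm_inj _ f); apply: (addrI (f y)).
  by rewrite -e' addrAC !bK e addrA.
have vU := MU a'A bM.
have e2 : a x = a' x + (a' b - b).
  by apply: (addIr b); rewrite -e1 (actE a'A); abel.
have cx : (a * a'^-1)%g x - x = a' b - b.
  rewrite permM e2 (actE (groupVr a'A)) permK (fixE (groupVr a'A) vU); abel.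
have cA : (a * a'^-1)%g \in A by rewrite groupM ?groupV.
have cU : (a * a'^-1)%g x - x \in U by rewrite cx.
have cb := trivial_act_shift cA (trivial_mod_fix cA xM cU) bB.
have -> : a b = a' b by rewrite -{2}cb permM permKV.
rewrite -(fixrad_act x a'A); apply/fixradP; split=> //.
by exists (a'^-1 * a)%g; rewrite ?groupM ?groupV // permM permK.
Qed.

Lemma hyperplane_addmod : x0 \in addmod U.
Proof.
apply/addmodP => y; have [a aA ea] := fA x0 y; pose F := im_group fix_invariant.
(* The [c] induced at [x0 + m] agrees with [a] at [x0] modulo [U], hence on [B]; by [shift_commute],
   [a b - b] lies in [W (x0 + m)] for every [m]. *)
have aB b : b \in B -> a b = b.
  move=> bB; have bM := subsetP shift_sub _ bB.
  apply/eqP; rewrite -subr_eq0; apply/eqP.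
  apply: (hyperplane_fixrad iM cardM x0M (MU aA bM)) => m mM.
  have mK w : f (w + m) - f w - f m \in F.
    by have /addmodP := subsetP (cen_addmod fix_invariant) _ mM; apply.
  have [c cA ec] := fA (x0 + m) y.
  have h1 := mK (x0 + y); have h2 := mK (c x0).
  have h3 : f (c (x0 + m)) - f (c x0 + m) \in F.
    rewrite /= im_sub; last exact: fix_invariant.
    by have := MU cA mM; rewrite (actE cA) => h; inlin (c m - m).
  have h4 : c x0 - a x0 \in U.
    rewrite -(im_sub _ _ fix_invariant) -[_ \in _]/(f (c x0) - f (a x0) \in F).
    have -> : f (c x0) - f (a x0) = (f (x0 + y + m) - f (x0 + y) - f m)
      - (f (c x0 + m) - f (c x0) - f m) - (f (c (x0 + m)) - f (c x0 + m)).
      have -> : x0 + y + m = x0 + m + y by abel.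
      by rewrite ec ea; abel.
    by ingrp.
  have dA : (a * c^-1)%g \in A by rewrite groupM ?groupV.
  have dU : (a * c^-1)%g x0 - x0 \in U.
    have := fix_invariant (groupVr cA) h4; rewrite permM !(actE (groupVr cA)) permK => h.
    by inlin (- (x0 - (c^-1)%g (a x0))).
  have db := trivial_act_shift dA (trivial_mod_fix dA x0M dU) bB.
  have -> : a b = c b by rewrite -{2}db permM permKV.
  by apply: shift_commute ec bB; rewrite ?grpDr.
suff aU : a x0 - x0 \in U.
  have -> : f (y + x0) - f y - f x0 = f (a x0) - f x0 by rewrite [y + x0]addrC ea; abel.
  by rewrite im_sub //; exact: fix_invariant.
(* It remains to see that [c] fixes [d = a x0 - x0]. As [a] fixes [B], and [a] and [c] commute on
   [M], the two products differ at [x0 + m] by [v = c d - d], which thus lies in every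
   [W (x0 + m)]. *)
apply/fixP => c cA; apply/eqP; rewrite -subr_eq0; apply/eqP.
have dM := subsetP shift_sub _ (act_shift aA).
set d := a x0 - x0 in dM *; pose v := c d - d; have vU : v \in U := MU cA dM.
apply: (hyperplane_fixrad iM cardM x0M vU) => m mM.
have e0 : c (a x0) = a (c x0) + v.
  have := aB _ (act_shift cA); rewrite (actE aA) (actE aA) => e.
  have -> : a (c x0) = c x0 - x0 + a x0 by rewrite -e; abel.
  by rewrite /v /d !(actE cA); abel.
have e1 : c (a m) = a (c m).
  have h1 := fixE cA (MU aA mM); have h2 := fixE aA (MU cA mM).
  rewrite !(actE cA) in h1; rewrite !(actE aA) in h2.
  have -> : c (a m) = a m - m + c m by rewrite -h1; abel.
  have -> : a (c m) = c m - m + a m by rewrite -h2; abel.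
  by abel.
pose g := (c * a)%g; have gA : g \in A by rewrite groupM.
rewrite -/v -(fixrad_act (x0 + m) gA); apply/fixradP; split=> //.
exists (g^-1 * (a * c))%g; first by rewrite !groupM ?groupV.
rewrite permM permK /g !permM; rewrite !(actE aA, actE cA) e0 e1; abel.
Qed.

End HyperplaneCase.

Lemma addmod_of_hyperplane : #|[set: H]| = (p * #|cen_group U|)%N ->
  (lg (cen_group U) <= lg U + 2)%N -> forall x, x \in addmod U.
Proof.
move=> cardM lgM.
have iM : invariant (cen_group U) := cen_invariant fix_invariant.
have outK x : x \notin cen_group U -> x \in addmod_group fix_invariant.
  exact: hyperplane_addmod.
have [x0 x0M] := notin_hyperplane cardM.
have := hyperplane_full (G := addmod_group fix_invariant) cardM
  (cen_addmod fix_invariant) (outK _ x0M) x0M.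
by [].
Qed.

(** * Trivial action on H / U1 *)

Lemma lg_prime_index E G : lg G = (lg E).+1 -> #|G| = (p * #|E|)%N.
Proof. by move=> e; rewrite (card_lg G) e expnS -card_lg. Qed.

Lemma lg_cycle_join E x : (lg (<[x]> <*> E)%G <= (lg E).+1)%N.
Proof.
have cx : (#|<[x]>%g| %| p ^ 1)%N.
  by rewrite expn1 -orderE order_dvdn FinRing.Theory.zmodXgE expH.
have ab : (<[x]> \subset 'C(E))%g.
  exact: subset_trans (subsetT _)
    (subset_trans (FinRing.Theory.zmod_abelian [set: H]) (centS (subsetT E))).
have := mul_cardG <[x]>%G E; rewrite -cent_joinEl // => e.
have : (#|(<[x]> <*> E)%g| <= p ^ (lg E).+1)%N.
  have := dvdn_leq (prime_gt0 p_pr) (cx : _ %| p)%N.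
  rewrite expnS -card_lg -(leq_pmul2r (cardG_gt0 E)) e; apply: leq_trans.
  by rewrite leq_pmulr ?cardG_gt0.
by rewrite {1}(card_lg (<[x]> <*> E)%G) leq_exp2l ?prime_gt1.
Qed.

Lemma cen_disp E a x : a \in A -> x \in cen_group E -> a x - x \in E.
Proof. by move=> aA /cenP; apply. Qed.

Section CentralQuotient.
Local Notation U1 := (cen_group U).
Hypotheses (lgU : lg U = 2%N) (lgU1 : lg U1 = 3%N) (lgH : lg [set: H]%G = 5%N).
Hypothesis dispU1 : forall a x, a \in A -> a x - x \in U1.
Variable e : H.
Hypotheses (eU1 : e \in U1) (eU : e \notin U).

Let iU : invariant U := fix_invariant.
Let sUU1 : U \subset U1 := sub_cen fix_invariant.
Let cardU1 : #|U1| = (p * #|U|)%N.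
Proof. by apply: lg_prime_index; rewrite lgU lgU1. Qed.
Let U1disp a n : a \in A -> n \in U1 -> a n - n \in U.
Proof. exact: cen_disp. Qed.
Local Notation gam a := (a e - e).
Let gamU (a : {perm H}) : a \in A -> gam a \in U.
Proof. by move=> aA; apply: U1disp. Qed.

Let exists_act x n : x \notin U1 -> n \in U1 -> exists2 a, a \in A & a x - x - n \in U.
Proof.
move=> xU1 nU1.
have [a aA aU] : exists2 a, a \in A & a x - x \notin U.
  by move: xU1; rewrite inE negb_forall => /existsP[a]; rewrite negb_imply => /andP[]; exists a.
have [k nk] := span_prime p_pr sUU1 cardU1 (dispU1 x aA) aU nU1.
exists (a ^+ k)%g; first exact: groupX.
have d0 : a x - x - (a x - x) \in U by rewrite subrr grp0.
have := actX_mod k iU aA d0 (U1disp aA (dispU1 x aA)) => h.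
inlin ((a ^+ k)%g x - x - (a x - x) *+ k - (n - (a x - x) *+ k)).
Qed.

Let fixrad_addU1 x n : x \notin U1 -> n \in U1 -> W (x + n) = W x.
Proof.
move=> xU1 nU1; have [a aA h] := exists_act xU1 nU1.
by apply: (fixrad_cong aA); inlin (- (a x - x - n)).
Qed.

Let neU1 : U1 != [set: H] :> {set H}.
Proof. by apply/eqP => h; have := lgU1; rewrite /= h lgH. Qed.

Let sepU1 u : u \in U -> (forall x, x \notin U1 -> u \in W x) -> u = 0.
Proof. exact: fixrad_separate (cen_invariant iU) neU1. Qed.

(** [W] is constant on [x + U1], so [a] moves both [x] and [x + e] by elements of [W x]; [gam a] is
    the difference. *)
Let gam_fixrad a x : a \in A -> x \notin U1 -> a x - x \in U -> gam a \in W x.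
Proof.
move=> aA xU1 xU.
have h1 : a x - x \in fixrad_group x.
  by apply/fixradP; split=> //; exists a => //; abel.
have h2 : a (x + e) - (x + e) \in fixrad_group x.
  rewrite /= -(fixrad_addU1 xU1 eU1); apply/fixradP; split; last by exists a => //; abel.
  by have := gamU aA; rewrite (actE aA) => h; inlin ((a x - x) + (a e - e)).
suff : gam a \in fixrad_group x by [].
by rewrite (actE aA) in h2; inlin ((a x + a e - (x + e)) - (a x - x)).
Qed.

Let gam_trivial a : a \in A -> (forall y, a y - y \in U) -> gam a = 0.
Proof. by move=> aA aU; apply: sepU1 => [|x xU1]; [apply: gamU|apply: gam_fixrad]. Qed.

Let dispM a c x : a \in A -> c \in A ->
  (a * c)%g x - x - ((a x - x) + (c x - x)) \in U.
Proof.
move=> aA cA; rewrite permM; have := U1disp cA (dispU1 x aA); rewrite !(actE cA) => h.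
inlin (c (a x) - c x - (a x - x)).
Qed.

Let dispX a k x : a \in A -> (a ^+ k)%g x - x - (a x - x) *+ k \in U.
Proof.
move=> aA; apply: actX_mod => //; last exact: U1disp (dispU1 x aA).
by rewrite subrr grp0.
Qed.

Let dispMV a c k x : a \in A -> c \in A ->
  (a * (c ^+ k)^-1)%g x - x - ((a x - x) - (c x - x) *+ k) \in U.
Proof.
move=> aA cA; have dA : (c ^+ k)%g \in A by apply: groupX.
have dVA := groupVr dA; have h1 := dispM x aA dVA; have h2 := dispM x dA dVA.
rewrite mulgV perm1 in h2; have h3 := dispX k x cA.
inlin ((a * (c ^+ k)^-1)%g x - x - (a x - x + ((c ^+ k)^-1%g x - x))
  - (x - x - ((c ^+ k)%g x - x + ((c ^+ k)^-1%g x - x)))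
  - ((c ^+ k)%g x - x - (c x - x) *+ k)).
Qed.

Let gamM a c : a \in A -> c \in A -> gam (a * c)%g = gam a + gam c.
Proof.
move=> aA cA; rewrite permM; have := fixE cA (gamU aA); rewrite !(actE cA) => <-.
by abel.
Qed.

Let gamX a k : a \in A -> gam (a ^+ k)%g = gam a *+ k.
Proof.
move=> aA; elim: k => [|k IH]; first by rewrite expg0 perm1 subrr.
by rewrite expgSr gamM ?groupX // IH mulrSr.
Qed.

Let gamMV a c k : a \in A -> c \in A -> gam (a * (c ^+ k)^-1)%g = gam a - gam c *+ k.
Proof.
move=> aA cA; have dA : (c ^+ k)%g \in A by apply: groupX.
rewrite gamM ?groupV // -gamX //; congr (_ + _); apply/eqP; rewrite -addr_eq0.
by rewrite -gamM ?groupV // mulVg perm1 subrr.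
Qed.

(** Let [E] be the group of points fixed by [a] modulo [U]. For [x] outside [E], any [a1] can be
    corrected by a power of [a], without changing [gam a1], to fix [x] modulo [U]; so [gam a1] lies
    in [W x]. Were [E] proper, [gam] would vanish on [A], against [e \notin U]. *)
Let gam_inj a : a \in A -> gam a = 0 -> forall y, a y - y \in U.
Proof.
move=> aA a0.
pose E : {set H} := [set x | a x - x \in U].
have EP x : (x \in E) = (a x - x \in U) by rewrite in_set.
have gE : group_set E.
  apply: add_group_set => [|x y]; rewrite !EP; first by rewrite act0 // subrr grp0.
  by rewrite (actE aA) => h1 h2; inlin ((a x - x) + (a y - y)).
have sU1E n : n \in U1 -> n \in E by rewrite EP; apply: U1disp.
have iE : invariant (Group gE).
  move=> c x cA xE; have nE := sU1E _ (dispU1 x cA).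
  by inlin (x + (c x - x)).
have [|neE] := eqVneq E [set: H].
  by move=> ET y; have := in_setT y; rewrite -ET EP.
have /existsP[a1] : [exists a1, (a1 \in A) && (gam a1 != 0)].
  apply: contraR eU; rewrite negb_exists => /forallP h; apply/fixP => c cA.
  by have := h c; rewrite cA negbK subr_eq0 => /eqP.
case/andP=> a1A /eqP[]; apply: (fixrad_separate (E := Group gE)) => //; first exact: gamU.
move=> x xE; have xU1 : x \notin U1 by apply: contra xE; apply: sU1E.
have xU : a x - x \notin U by rewrite -EP.
have [k xk] := span_prime p_pr sUU1 cardU1 (dispU1 x aA) xU (dispU1 x a1A).
have cA : (a1 * (a ^+ k)^-1)%g \in A by rewrite groupM ?groupV ?groupX.
have <- : gam (a1 * (a ^+ k)^-1)%g = gam a1 by rewrite gamMV // a0 mul0rn subr0.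
apply: gam_fixrad => //; have h := dispMV k x a1A aA.
inlin ((a1 * (a ^+ k)^-1)%g x - x - ((a1 x - x) - (a x - x) *+ k) + ((a1 x - x) - (a x - x) *+ k)).
Qed.

(** Otherwise the elements fixing [x] modulo [U] are trivial modulo [U], and modulo these all of [A]
    consists of powers of one [a]. Subtracting a multiple of [x] from some [y] outside [<x, U1>]
    gives a point fixed by [a], hence by [A], modulo [U]: a point of [U1], a contradiction. *)
Let exists_stab x : x \notin U1 -> exists a, [/\ a \in A, a x - x \in U & gam a != 0].
Proof.
move=> xU1.
suff : [exists a, [&& a \in A, a x - x \in U & gam a != 0]].
  by case/existsP => a /and3P[]; exists a.
apply: contraT; rewrite negb_exists => /forallP h.
have stab c : c \in A -> c x - x \in U -> forall y, c y - y \in U.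
  move=> cA cU; apply: gam_inj => //; have := h c.
  by rewrite cA cU negbK => /eqP.
have [a aA ae] := exists_act xU1 eU1.
have [y yG] : exists y, y \notin (<[x]> <*> U1)%G.
  apply/existsP; apply: contraT; rewrite negb_exists => /forallP all_in.
  have : (lg [set: H]%G <= 4)%N.
    apply: leq_trans (lg_sub _) (leq_trans (lg_cycle_join U1 x) _); last by rewrite lgU1.
    by apply/subsetP => y _; have := all_in y; rewrite negbK.
  by rewrite lgH.
have [k yk] := span_prime p_pr sUU1 cardU1 eU1 eU (dispU1 y aA).
have xG : x \in (<[x]> <*> U1)%G by rewrite mem_gen // inE cycle_id.
have : y - x *+ k \in U1.
  apply/cenP => c cA.
  have [j cj] := span_prime p_pr sUU1 cardU1 eU1 eU (dispU1 x cA).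
  have dA : (c * (a ^+ j)^-1)%g \in A by rewrite groupM ?groupV ?groupX.
  have h1 := dispMV j x cA aA; have h2 := dispMV j (y - x *+ k) cA aA.
  have h3 : (a x - x - e) *+ j \in U by apply: grpMn.
  rewrite mulrnBl in h3.
  have dx : (c * (a ^+ j)^-1)%g x - x \in U.
    inlin ((c * (a ^+ j)^-1)%g x - x - ((c x - x) - (a x - x) *+ j)
      + (c x - x - e *+ j) - ((a x - x) *+ j - e *+ j)).
  have dy := stab _ dA dx (y - x *+ k).
  have h4 : (a (y - x *+ k) - (y - x *+ k)) *+ j \in U.
    apply: grpMn; rewrite !(actE aA) actMn //.
    have h5 : (a x - x - e) *+ k \in U by apply: grpMn.
    rewrite !mulrnBl in h5.
    inlin ((a y - y - e *+ k) - (a x *+ k - x *+ k - e *+ k)).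
  set z := y - x *+ k in h2 dy h4 *.
  inlin (((c * (a ^+ j)^-1)%g z - z) - ((c * (a ^+ j)^-1)%g z - z - (c z - z - (a z - z) *+ j)) + (a z - z) *+ j).
move=> yU1; have := subsetP (joing_subr <[x]>%G U1) _ yU1 => yG'.
by case/negP: yG; inlin (y - x *+ k + x *+ k).
Qed.

(** For these [x], [W x] is a line: the image under [gam] of the elements fixing [x] modulo [U]
    ([gam_fixrad], [good_stab]). *)
Let good x := (x \notin U1) && (lg (fixrad_group x) <= 1)%N.

Let good_of_notin x u : x \notin U1 -> u \in U -> u \notin W x -> good x.
Proof.
move=> xU1 uU ux; rewrite /good xU1 -ltnS -lgU lg_proper //.
by rewrite properE fixrad_sub; apply: contra ux => /subsetP; apply.
Qed.

Let good_stab x w : good x -> w \in W x ->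
  exists a, [/\ a \in A, a x - x \in U & gam a = w].
Proof.
case/andP=> xU1 x1 wW; have [c [cA cU c0]] := exists_stab xU1.
have cW : gam c \in fixrad_group x by apply: gam_fixrad.
have W1 : #|fixrad_group x| = (p * #|(1%G : {group H})|)%N.
  rewrite cards1 muln1 (card_lg (fixrad_group x)); have -> : lg (fixrad_group x) = 1%N; last exact: expn1.
  apply/eqP; rewrite eqn_leq x1 lt0n; apply: contra c0 => /eqP x0.
  by apply/eqP; apply: lg0 x0 cW.
have c1 : gam c \notin 1%G by rewrite inE; exact: c0.
have [k] := span_prime p_pr (sub1G _) W1 cW c1 wW.
move=> /set1gP /eqP; rewrite -[1%g]/(0 : H) subr_eq0 => /eqP wk.
exists (c ^+ k)%g; split; first exact: groupX.
  have h := dispX k x cA; have h' : (c x - x) *+ k \in U by apply: grpMn.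
  by inlin ((c ^+ k)%g x - x - (c x - x) *+ k + (c x - x) *+ k).
by rewrite gamX.
Qed.

Let good_gam x a : good x -> a \in A -> gam a \in W x -> a x - x \in U.
Proof.
move=> gx aA aW; have [c [cA cU ca]] := good_stab gx aW.
have dA : (a * (c ^+ 1)^-1)%g \in A by rewrite groupM ?groupV ?groupX.
have d0 : gam (a * (c ^+ 1)^-1)%g = 0 by rewrite gamMV // ca subrr.
have h := dispMV 1 x aA cA; have h' := gam_inj dA d0 x.
inlin ((a * (c ^+ 1)^-1)%g x - x - ((a * (c ^+ 1)^-1)%g x - x - (a x - x - (c x - x) *+ 1)) + (c x - x)).
Qed.

Let defect y := f (y + e) - f y - f e.

Let e_addmod y : defect y \in im_group iU.
Proof. by have /addmodP := subsetP (cen_addmod iU) _ eU1; apply. Qed.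

Let defect0 : defect 0 = 0.
Proof. by rewrite /defect add0r f0; abel. Qed.

Let defect_diff z y : defect (y + z) - defect y = diff2 e z y.
Proof. by rewrite /defect /diff2; abel. Qed.

Let defectD y z : defect (y + z) = defect y + defect z.
Proof.
have eK := subsetP (cen_addmod iU) _ eU1.
have aff : affine defect.
  apply: (@affine_of_lg2 U) => [//||w v|w v]; first by rewrite lgU.
    by rewrite defect_diff; apply: diff2_fixrad.
  exact: (grpB (G := im_group iU)).
by have := aff z y; rewrite defect0 subr0 => <-; abel.
Qed.

Let T y := (f^-1)%g (defect y).

Let fT y : f (T y) = defect y. Proof. exact: permKV. Qed.

Let TU y : T y \in U. Proof. by rewrite -im_mem fT; apply: e_addmod. Qed.

Let T_fixrad y : T y \in W y.
Proof.
rewrite -im_mem fT; have eK := subsetP (cen_addmod iU) _ eU1.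
by have := diff2_fixrad y 0 eK; rewrite -defect_diff add0r defect0 subr0.
Qed.

Let TD y z : T (y + z) = T y + T z.
Proof. by apply: (@perm_inj _ f); rewrite im_addU // !fT defectD. Qed.

Let T0 : T 0 = 0.
Proof. by apply: (@perm_inj _ f); rewrite fT defect0 f0. Qed.

Let T_group_set : group_set [set y | T y == 0].
Proof.
apply: add_group_set => [|y z]; rewrite !in_set ?T0 // TD => /eqP-> /eqP->.
by rewrite addr0.
Qed.
Let kerT := Group T_group_set.

(** [T] vanishes on [U], along which [f] is additive; and [T e = T (x + e) - T x] lies in [W x] for
    every [x] outside [U1], so it is zero. *)
Let kerTU1 : U1 \subset kerT.
Proof.
have Tu u : u \in U -> u \in kerT.
  move=> uU; rewrite in_set -(inj_eq (@perm_inj _ f)) fT f0 /defect [u + e]addrC.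
  by rewrite im_addU // addrK subrr.
have Te : e \in kerT.
  rewrite in_set; apply/eqP; apply: sepU1 => // x xU1.
  have h1 : T (x + e) \in fixrad_group x by rewrite /= -(fixrad_addU1 xU1 eU1).
  have h2 : T x \in fixrad_group x by [].
  suff : T e \in fixrad_group x by [].
  by rewrite TD in h1; inlin (T x + T e - T x).
apply/subsetP => n nU1; have [k nk] := span_prime p_pr sUU1 cardU1 eU1 eU nU1.
have := Tu _ nk => nk'.
inlin (n - e *+ k + e *+ k).
Qed.

Let TU1 n : n \in U1 -> T n = 0.
Proof. by move/(subsetP kerTU1); rewrite in_set => /eqP. Qed.

(** Let [c] be induced at [x + e]. Comparing two expressions for [f (x + e + y)] gives
    [c (x + e) = a x + e + T y], so [gam c - T y] lies in [W x]; by [gam_fixrad] so does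
    [gam a - gam c]. *)
Let transport_gam x y a : x \notin U1 -> a \in A -> f (x + y) = f y + f (a x) ->
  gam a - T y \in W x.
Proof.
move=> xU1 aA ea; have [c cA ec] := fA (x + e) y.
have Ta : T (a x) = T x.
  have -> : a x = x + (a x - x) by abel.
  by rewrite TD (TU1 (dispU1 x aA)) addr0.
have fe z : f (z + e) = f z + f e + f (T z) by rewrite fT /defect; abel.
have e1 : c (x + e) = a x + e + T y.
  apply: (@perm_inj _ f); apply: (addrI (f y)).
  rewrite -ec (im_addU _ (TU y)) fe Ta [x + e + y]addrAC fe TD (im_addU _ (TU y)) ea.
  by abel.
have vU : gam c - T y \in U by rewrite grpB ?gamU.
have e2 : a x = c x + (gam c - T y).
  by apply: (addIr (e + T y)); rewrite [a x + _]addrA -e1 (actE cA); abel.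
have vW : gam c - T y \in fixrad_group x.
  rewrite /= -(fixrad_act x cA); apply/fixradP; split=> //.
  by exists (c^-1 * a)%g; rewrite ?groupM ?groupV // permM permK.
have cVA := groupVr cA.
have dx : (a * c^-1)%g x - x \in U.
  by rewrite permM e2 (actE cVA) permK (fixE cVA vU); inlin (gam c - T y).
have dA : (a * c^-1)%g \in A by rewrite groupM.
have gW : gam (a * c^-1)%g \in fixrad_group x by apply: gam_fixrad.
have gac := gamMV 1 aA cA; rewrite expg1 mulr1n in gac; rewrite gac in gW.
suff : gam a - T y \in fixrad_group x by [].
inlin (gam a - gam c + (gam c - T y)).
Qed.

Let goodX x k k' : (forall z : H, z *+ k *+ k' = z) -> good x -> good (x *+ k).
Proof.
move=> kk' /andP[xU1 x1]; apply/andP; split; last by rewrite /= (fixrad_muln _ kk').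
by apply: contra xU1 => h; rewrite -(kk' x) grpMn.
Qed.

Let exists_notin (G : {group H}) u : u \in U -> u != 0 -> G != [set: H] :> {set H} ->
  exists2 x, x \notin G & u \notin W x.
Proof.
move=> uU u0 neG; suff : [exists (x | x \notin G), u \notin W x] by case/exists_inP=> x; exists x.
apply: contraT => /exists_inPn h; case/negP: neG; apply/eqP/setP => x; rewrite inE.
apply: (fixrad_span uU u0) => {}x ux; apply: contraT => /h; by rewrite ux.
Qed.

(** Take a good [x1] and [w != 0] in [W x1], then [x2] outside [<x1, U1>] and [x3] outside
    [<x2, U1>], with [w] in neither [W x2] nor [W x3]. Modulo [U1], [x3] combines [x1] and [x2] with
    coefficients prime to [p]. *)
Let three_good : exists x y, [/\ good x, good y, good (x + y) &
  forall G : {group H}, U1 \subset G -> x \in G -> y \in G -> forall z, z \in G].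
Proof.
have [u uU u0] : exists2 u, u \in U & u != 0 by apply: nontriv; rewrite lgU.
have [x1 x1U1 ux1] := exists_notin uU u0 neU1.
have gx1 := good_of_notin x1U1 uU ux1.
have [c [cA cU c0]] := exists_stab x1U1.
have wW := gam_fixrad cA x1U1 cU; set w := gam c in wW c0.
have wU := subsetP (fixrad_sub x1) _ wW.
pose G1 := (<[x1]> <*> U1)%G.
have sUG x : U1 \subset (<[x]> <*> U1)%G by apply: joing_subr.
have memG x : x \in (<[x]> <*> U1)%G by rewrite mem_gen // inE cycle_id.
have neG x : (<[x]> <*> U1)%G != [set: H] :> {set H}.
  by apply/eqP => h; have := lg_cycle_join U1 x; rewrite h lgH lgU1.
have [x2 x2G wx2] := exists_notin wU c0 (neG x1).
have x2U1 : x2 \notin U1 by apply: contra x2G; apply: (subsetP (sUG _)).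
have gx2 := good_of_notin x2U1 wU wx2.
have [x3 x3G wx3] := exists_notin wU c0 (neG x2).
have x3U1 : x3 \notin U1 by apply: contra x3G; apply: (subsetP (sUG _)).
have gx3 := good_of_notin x3U1 wU wx3.
have lgG1 : lg G1 = 4%N.
  apply/eqP; rewrite eqn_leq; have := lg_cycle_join U1 x1; rewrite lgU1 => -> /=.
  rewrite -lgU1 lg_proper // properE sUG; apply: contra x1U1 => /subsetP; apply.
  exact: memG.
have cardG1 : #|[set: H]%G| = (p * #|G1|)%N by apply: lg_prime_index; rewrite lgH lgG1.
have [j x3j] := hyperplane_span cardG1 x3 x2G.
have [i x3i] := mem_cycle_join x3j.
have unit k : ~~ (p %| k)%N -> exists k', forall z : H, z *+ k *+ k' = z.
  exact: muln_inverse.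
have dvd0 k (z : H) : (p %| k)%N -> z *+ k = 0.
  by case/dvdnP => l ->; rewrite mulnC mulrnA expH mul0rn.
have pi : ~~ (p %| i)%N.
  apply: contra x3G => /dvd0 i0; rewrite i0 subr0 in x3i.
  have h1 := subsetP (sUG x2) _ x3i; have h2 := memG x2.
  by inlin (x3 - x2 *+ j + x2 *+ j).
(* If [p] divided [j], then [W x3] would equal [W x1], which contains [w]. *)
have pj : ~~ (p %| j)%N.
  apply: contra wx3 => /dvd0 j0; rewrite j0 subr0 in x3i.
  have [i' ii'] := unit _ pi.
  have x1i : x1 *+ i \notin U1 by apply: contra x1U1 => h; rewrite -(ii' x1) grpMn.
  by have := fixrad_addU1 x1i x3i; rewrite addrC subrK (fixrad_muln _ ii') => ->.
have [i' ii'] := unit _ pi; have [j' jj'] := unit _ pj.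
exists (x1 *+ i), (x2 *+ j); split; try exact: goodX.
  have nU1 : - (x3 - x2 *+ j - x1 *+ i) \in U1 by apply: grpN.
  have -> : x1 *+ i + x2 *+ j = x3 + - (x3 - x2 *+ j - x1 *+ i) by abel.
  case/andP: gx3 => _ g3; apply/andP; split; last by rewrite /= fixrad_addU1.
  by rewrite grpDr.
move=> G sUG' xG yG.
have x1G : x1 \in G by rewrite -(ii' x1) grpMn.
have x2G' : x2 \in G by rewrite -(jj' x2) grpMn.
by apply: (hyperplane_full cardG1 _ x2G' x2G); rewrite join_subG cycle_subG x1G.
Qed.

(** Let [c] and [c'] fix [x2] and [x1] modulo [U], with [gam] values [T x2] and [T x1]. Expanding
    [f (x1 + x2)] in both orders shows that [c] moves [x1] as [c'] moves [x2], modulo [U]; but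
    [c * c'] fixes [x1 + x2], so these displacements are also opposite. As [p] is odd they vanish,
    and [c] and [c'] are trivial modulo [U]. *)
Let T_eq0 y : T y = 0.
Proof.
have [x1 [x2 [g1 g2 g3 gen]]] := three_good.
pose F := im_group iU.
have /andP[x1U1 _] := g1; have /andP[x2U1 _] := g2.
have [a aA ea] := fA x1 x2; have [a' a'A ea'] := fA x2 x1.
have [c [cA cU ce]] := good_stab g2 (T_fixrad x2).
have [c' [c'A c'U ce']] := good_stab g1 (T_fixrad x1).
have stab x y1 (b d : {perm H}) : good x -> b \in A -> d \in A -> f (x + y1) = f y1 + f (b x) ->
    gam d = T y1 -> (b x - x) - (d x - x) \in U.
  move=> gx bA dA eb ed; have /andP[xU1 _] := gx.
  have := transport_gam xU1 bA eb; rewrite -ed => h.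
  have bd := gamMV 1 bA dA; rewrite -bd in h.
  have bdA : (b * (d ^+ 1)^-1)%g \in A by rewrite groupM ?groupV ?groupX.
  have h1 := good_gam gx bdA h; have h2 := dispMV 1 x bA dA.
  inlin ((b * (d ^+ 1)^-1)%g x - x - ((b * (d ^+ 1)^-1)%g x - x - (b x - x - (d x - x) *+ 1))).
have h1 := stab _ _ _ _ g1 aA cA ea ce.
have h2 := stab _ _ _ _ g2 a'A c'A ea' ce'.
have U1K x n : n \in U1 -> f (x + n) - f x - f n \in F.
  by move=> nU1; have /addmodP := subsetP (cen_addmod iU) _ nU1; apply.
have h3 : (a x1 - x1) - (a' x2 - x2) \in U.
  have k1 := U1K x1 _ (dispU1 x1 aA); have k2 := U1K x2 _ (dispU1 x2 a'A).
  have e1 : x1 + (a x1 - x1) = a x1 by abel.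
  have e2 : x2 + (a' x2 - x2) = a' x2 by abel.
  rewrite e1 in k1; rewrite e2 in k2.
  rewrite -(im_sub _ _ iU) -[_ \in _]/(f (a x1 - x1) - f (a' x2 - x2) \in F).
  have e3 : f x2 + f (a x1) = f x1 + f (a' x2) by rewrite -ea -ea' addrC.
  have -> : f (a x1 - x1) - f (a' x2 - x2) = (f (a' x2) - f x2 - f (a' x2 - x2))
    - (f (a x1) - f x1 - f (a x1 - x1)) + (f x2 + f (a x1)) - (f x1 + f (a' x2)) by abel.
  by rewrite e3 addrK; ingrp.
have h4 : (c * c')%g (x1 + x2) - (x1 + x2) \in U.
  apply: good_gam => //; first exact: groupM.
  by rewrite gamM // ce ce' addrC -TD.
have h5 := dispM (x1 + x2) cA c'A.
have h6 : (c x1 - x1) + (c x1 - x1) \in U.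
  rewrite (actE cA) (actE c'A) in h5; set z := _ (x1 + x2) in h4 h5.
  inlin ((z - (x1 + x2)) - (z - (x1 + x2) - (c x1 + c x2 - (x1 + x2) + (c' x1 + c' x2 - (x1 + x2))))
    - (c x2 - x2) - (c' x1 - x1)
    + (a' x2 - x2 - (c' x2 - x2)) - (a x1 - x1 - (c x1 - x1)) + (a x1 - x1 - (a' x2 - x2))).
have h7 := grp_half p_pr expH p_odd h6.
have h8 : c' x2 - x2 \in U.
  inlin ((c x1 - x1) - (a' x2 - x2 - (c' x2 - x2)) + (a x1 - x1 - (c x1 - x1)) - (a x1 - x1 - (a' x2 - x2))).
have trivial (d : {perm H}) : d \in A -> d x1 - x1 \in U -> d x2 - x2 \in U -> gam d = 0.
  move=> dA d1 d2; apply: gam_trivial => //.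
  pose S : {set H} := [set x | d x - x \in U].
  have SP x : (x \in S) = (d x - x \in U) by rewrite in_set.
  have gS : group_set S.
    apply: add_group_set => [|x z]; rewrite !SP; first by rewrite act0 // subrr grp0.
    by rewrite (actE dA) => k1 k2; inlin ((d x - x) + (d z - z)).
  move=> z; rewrite -SP; apply: (gen (Group gS)); rewrite /= ?SP //.
  by apply/subsetP => n nU1; rewrite SP; apply: U1disp.
have T2 : T x2 = 0 by rewrite -ce; apply: trivial.
have T1 : T x1 = 0 by rewrite -ce'; apply: trivial.
have := gen kerT kerTU1; rewrite !in_set T1 T2 !eqxx => /(_ isT isT y).
by rewrite in_set => /eqP.
Qed.

Lemma addmod_of_central_quotient x : x \in addmod U.
Proof.
have [u uU u0] : exists2 u, u \in U & u != 0 by apply: nontriv; rewrite lgU.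
apply: (fixrad_span (G := addmod_group iU) uU u0) => {}x ux.
have [/(subsetP (cen_addmod iU))//|xU1] := boolP (x \in U1).
have gx := good_of_notin xU1 uU ux.
apply/addmodP => y; have [a aA ea] := fA x y.
have := transport_gam xU1 aA ea; rewrite T_eq0 subr0 => /(good_gam gx aA) h.
have -> : f (y + x) - f y - f x = f (a x) - f x by rewrite [y + x]addrC ea; abel.
by rewrite im_sub.
Qed.

End CentralQuotient.

(** * Nontrivial action on H / U1 *)

Section NoncentralQuotient.
Local Notation U1 := (cen_group U).
Local Notation M := (cen_group U1).
Hypothesis cardM : #|[set: H]| = (p * #|M|)%N.

Let iU : invariant U := fix_invariant.
Let iU1 : invariant U1 := cen_invariant iU.
Let iM : invariant M := cen_invariant iU1.
Let sUU1 : U \subset U1 := sub_cen iU.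
Let sU1M : U1 \subset M := sub_cen iU1.
Let U1disp a n : a \in A -> n \in U1 -> a n - n \in U.
Proof. exact: cen_disp. Qed.
Let Mdisp a m : a \in A -> m \in M -> a m - m \in U1.
Proof. exact: cen_disp. Qed.

Let act_notin a x : a \in A -> x \notin M -> a x \notin M.
Proof.
move=> aA; apply: contra => axM; have h := hyperplane_act iM cardM x aA.
by inlin (a x - (a x - x)).
Qed.

Lemma addmod_of_semiregular :
  (forall a x, a \in A -> x \notin M -> a x - x \in U1 -> a x - x \in U) ->
  forall x, x \in addmod U.
Proof.
move=> semireg; pose F := im_group iU; pose F1 := im_group iU1.
have MK m : m \in M -> m \in addmod U.
  move=> mM; have /addmodP mK1 := subsetP (cen_addmod iU1) _ mM.
  pose h y := f (y + m) - f y.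
  (* [f] is additive along [m] modulo [U1], so [a z] and [c z] agree modulo [U1]; by hypothesis they
     agree modulo [U]. *)
  have hF z y : h (y + z) - h y \in F.
    apply: (hyperplane_const cardM) => {}z {}y zM.
    have [a aA ea] := fA z (y + m); have [c cA ec] := fA z y.
    have e : h (y + z) - h y = f (a z) - f (c z).
      rewrite /h; have -> : y + z + m = z + (y + m) by abel.
      by rewrite ea [y + z]addrC ec; abel.
    have k1 : a z - c z \in U1.
      rewrite -(im_sub _ _ iU1) -e -[_ \in _]/(h (y + z) - h y \in F1).
      have q1 : f (y + z + m) - f (y + z) - f m \in F1 := mK1 (y + z).
      have q2 : f (y + m) - f y - f m \in F1 := mK1 y.
      by rewrite /h; inlin ((f (y + z + m) - f (y + z) - f m) - (f (y + m) - f y - f m)).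
    have k2 : (c^-1)%g (a z) - z \in U.
      have e1 : (c^-1)%g (a z) = (a * c^-1)%g z by rewrite permM.
      rewrite e1; apply: semireg => //; first by rewrite groupM ?groupV.
      by rewrite -e1; have := @iU1 _ _ (groupVr cA) k1; rewrite !(actE (groupVr cA)) permK.
    rewrite e; suff : a z - c z \in U by rewrite -(im_sub _ _ iU).
    by have := @iU _ _ cA k2; rewrite !(actE cA) permKV.
  apply/addmodP => y; have := hF y 0; rewrite add0r /h add0r f0 subr0.
  by [].
have outK x : x \notin M -> x \in addmod U.
  move=> xM; apply/addmodP => y; have [a aA ea] := fA x y.
  (* [a] and the [c] induced at [x + m] agree modulo [U] at [x] and at [x + m], hence at [m], which
     [c] fixes modulo [U]. *)
  have aM m : m \in M -> a m - m \in U.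
    move=> mM; have [c cA ec] := fA (x + m) y.
    have /addmodP mK := MK m mM.
    have k0 : c (x + m) - (a x + m) \in U.
      rewrite -(im_sub _ _ iU) -[_ \in _]/(f (c (x + m)) - f (a x + m) \in F).
      have q1 : f (x + y + m) - f (x + y) - f m \in F := mK (x + y).
      have q2 : f (a x + m) - f (a x) - f m \in F := mK (a x).
      have -> : f (c (x + m)) - f (a x + m) = (f (x + y + m) - f (x + y) - f m)
        - (f (a x + m) - f (a x) - f m).
        have -> : x + y + m = x + m + y by abel.
        by rewrite ec ea; abel.
      by ingrp.
    have cmU1 := Mdisp cA mM.
    have k1 : c x - a x \in U1.
      have k0' := subsetP sUU1 _ k0; rewrite (actE cA) in k0'.
      by inlin (c x + c m - (a x + m) - (c m - m)).
    have cVA := groupVr cA.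
    have dA : (a * c^-1)%g \in A by rewrite groupM.
    have k2 : (a * c^-1)%g x - x \in U.
      apply: semireg => //; rewrite permM.
      have := @iU1 _ _ cVA k1; rewrite !(actE cVA) permK => k1'.
      by inlin (- (x - (c^-1)%g (a x))).
    have k3 : c x - a x \in U.
      have := @iU _ _ cA k2; rewrite !(actE cA) permM permKV => k2'.
      by inlin (- (a x - c x)).
    have k4 : c m - m \in U.
      by rewrite (actE cA) in k0; inlin (c x + c m - (a x + m) - (c x - a x)).
    have dm1 := Mdisp dA mM.
    have k5 : (a * c^-1)%g (x + m) - (x + m) \in U.
      apply: semireg => //; first by rewrite grpDr.
      rewrite (actE dA).
      have k2' := subsetP sUU1 _ k2.
      inlin (((a * c^-1)%g x - x) + ((a * c^-1)%g m - m)).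
    have k6 : (a * c^-1)%g m - m \in U.
      rewrite (actE dA) in k5; set d := (a * c^-1)%g in k2 k5 *.
      inlin ((d x + d m - (x + m)) - (d x - x)).
    have := @iU _ _ cA k6; rewrite (actE cA) (actN _ cA) permM permKV => k7.
    by inlin (a m - c m + (c m - m)).
  have dM := hyperplane_act iM cardM x aA.
  have [d ed] : exists d, d = a x - x by exists (a x - x).
  rewrite -ed in dM *.
  suff dU : d \in U.
    have -> : f (y + x) - f y - f x = f (a x) - f x by rewrite [y + x]addrC ea; abel.
    by rewrite im_sub // -ed.
  (* It suffices that [d] lies in [U1], that is [c d - d] in [U]. Modulo [U] this is
     [c (a x) - a (c x)], a displacement in [U1] of a point outside [M], hence in [U]. *)
  rewrite ed; apply: (semireg) => //; rewrite -ed; apply/cenP => c cA.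
  have k1 := aM _ (hyperplane_act iM cardM x cA).
  have k2 : c (a x) - a (c x) - (c d - d) \in U.
    rewrite ed !(actE cA); rewrite !(actE aA) in k1.
    by inlin (- (a (c x) - a x - (c x - x))).
  have gA : (c * a)%g \in A by rewrite groupM.
  have wA : ((c * a)^-1 * (a * c))%g \in A by rewrite !groupM ?groupV ?groupM.
  have k3 : ((c * a)^-1 * (a * c))%g (a (c x)) = c (a x).
    have -> : a (c x) = (c * a)%g x by rewrite permM.
    by rewrite [LHS]permM permK permM.
  have k4 : c (a x) - a (c x) \in U.
    rewrite -k3; apply: semireg; rewrite ?act_notin // k3.
    have k2' := subsetP sUU1 _ k2; have k5 := Mdisp cA dM.
    by inlin (c (a x) - a (c x) - (c d - d) + (c d - d)).
  by inlin (c (a x) - a (c x) - (c (a x) - a (c x) - (c d - d))).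
have [x xM] := notin_hyperplane cardM.
apply: (hyperplane_full (G := addmod_group iU) cardM _ (outK _ xM) xM).
by apply/subsetP => m /MK.
Qed.

(** * Orbits outside [M] that are transitive modulo [U] *)

Section Transitive.
Hypotheses (cardU1 : #|U1| = (p * #|U|)%N) (cardMU1 : #|M| = (p * #|U1|)%N).
Hypothesis lgMU : lg M = (lg U).+2.
Variables (x1 : H) (a1 : {perm H}).
Hypotheses (x1M : x1 \notin M) (a1A : a1 \in A).
Hypotheses (a1U1 : a1 x1 - x1 \in U1) (a1U : a1 x1 - x1 \notin U).

Let exists_move x : x \notin M -> exists2 a, a \in A & a x - x \notin U1.
Proof.
move=> xM; have : x \notin cen U1 by [].
by rewrite inE negb_forall => /existsP[a]; rewrite negb_imply => /andP[]; exists a.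
Qed.

Let exists_act1 n : n \in U1 -> exists2 a, a \in A & a x1 - x1 - n \in U.
Proof.
move=> nU1; have [k nk] := span_prime p_pr sUU1 cardU1 a1U1 a1U nU1.
exists (a1 ^+ k)%g; first exact: groupX.
have d0 : a1 x1 - x1 - (a1 x1 - x1) \in U by rewrite subrr grp0.
have h := actX_mod k iU a1A d0 (U1disp a1A a1U1).
inlin ((a1 ^+ k)%g x1 - x1 - (a1 x1 - x1) *+ k - (n - (a1 x1 - x1) *+ k)).
Qed.

Let exists_actM1 n : n \in M -> exists2 a, a \in A & a x1 - x1 - n \in U.
Proof.
move=> nM; have [a aA aU1] := exists_move x1M.
have aM := hyperplane_act iM cardM x1 aA.
have [k nk] := span_prime p_pr sU1M cardMU1 aM aU1 nM.
have d0 : a x1 - x1 - (a x1 - x1) \in U1 by rewrite subrr grp0.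
have h := actX_mod k iU1 aA d0 (Mdisp aA aM).
have aX : (a ^+ k)%g \in A by apply: groupX.
set c := (a ^+ k)%g in aX h.
have nU1 : n - (c x1 - x1) \in U1.
  inlin (n - (a x1 - x1) *+ k - (c x1 - x1 - (a x1 - x1) *+ k)).
have [g gA gn] := exists_act1 nU1.
exists (g * c)%g; first exact: groupM.
have k1 := @iU _ _ aX gn; have k2 := U1disp aX nU1.
rewrite !(actE aX) in k1; rewrite !(actE aX) in k2; rewrite permM.
inlin (c (g x1) - c x1 - (c n - (c (c x1) - c x1)) + (c n - (c (c x1) - c x1) - (n - (c x1 - x1)))).
Qed.

(** Modulo [U], both [x] and [x + n] are the same multiple [k] of points in the orbit of [x1], which
    covers [x1 + M] by [exists_actM1]. *)
Let exists_actM x n : x \notin M -> n \in M -> exists2 a, a \in A & a x - x - n \in U.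
Proof.
move=> xM nM; have [k [k' [kk' xk]]] := hyperplane_span_unit cardM x1M xM.
have [c cA cx] : exists2 c, c \in A & c x1 *+ k - x \in U.
  have mM : (x - x1 *+ k) *+ k' \in M by apply: grpMn.
  have [c cA h] := exists_actM1 mM; exists c => //.
  have h' : (c x1 - x1 - (x - x1 *+ k) *+ k') *+ k \in U by apply: grpMn.
  rewrite 2!mulrnBl [(x - x1 *+ k) *+ k' *+ k]mulrnAC kk' in h'.
  by inlin (c x1 *+ k - x1 *+ k - (x - x1 *+ k)).
have [g gA gx] : exists2 g, g \in A & g x1 *+ k - (x + n) \in U.
  have mM : (x - x1 *+ k + n) *+ k' \in M by apply: grpMn; apply: grpD.
  have [g gA h] := exists_actM1 mM; exists g => //.
  have h' : (g x1 - x1 - (x - x1 *+ k + n) *+ k') *+ k \in U by apply: grpMn.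
  rewrite 2!mulrnBl [(x - x1 *+ k + n) *+ k' *+ k]mulrnAC kk' in h'.
  by inlin (g x1 *+ k - x1 *+ k - (x - x1 *+ k + n)).
have cVA := groupVr cA.
exists (c^-1 * g)%g; first by rewrite groupM.
have h1 := @iU _ _ cVA cx; rewrite (actE cVA) (actN _ cVA) (actMn _ _ cVA) permK in h1.
have h2 := @iU _ _ gA h1; rewrite (actE gA) (actN _ gA) (actMn _ _ gA) in h2.
rewrite permM; inlin (g x1 *+ k - (x + n) - (g x1 *+ k - g ((c^-1)%g x))).
Qed.

Let fixrad0 x : x \notin M -> forall u, u \in W x -> u = 0.
Proof.
move=> xM u uW; apply: (hyperplane_fixrad iM cardM xM (subsetP (fixrad_sub x) _ uW)).
move=> m mM; have [a aA am] := exists_actM xM mM.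
by rewrite (@fixrad_cong a x) //; inlin (- (a x - x - m)).
Qed.

Let stab_fix a x : a \in A -> x \notin M -> a x - x \in U -> a x = x.
Proof.
move=> aA xM xU; apply/eqP; rewrite -subr_eq0; apply/eqP; apply: (fixrad0 xM).
by apply/fixradP; split=> //; exists a => //; abel.
Qed.

Let U1_additive n : n \in U1 -> n \in addset.
Proof.
move=> nU1; apply: (hyperplane_additive cardM fixrad0).
exact: subsetP (cen_addmod iU) _ nU1.
Qed.

Let trivial_mod_U1 a x : a \in A -> x \notin M -> a x - x \in U1 ->
  forall y, a y - y \in U1.
Proof.
move=> aA xM xU1 y; have [k yk] := hyperplane_span cardM y xM.
have := Mdisp aA yk; rewrite !(actE aA) actMn // => h.
have : (a x - x) *+ k \in U1 by apply: grpMn.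
rewrite mulrnBl => h'.
inlin ((a y - a x *+ k - (y - x *+ k)) + (a x *+ k - x *+ k)).
Qed.

(** Some [g x] is congruent to [x + n] modulo [U]; [c] moves it by [c n - n], an element of [U],
    hence not at all by [stab_fix]. *)
Let stab_fixU1 c x n : c \in A -> x \notin M -> c x = x -> n \in U1 -> c n = n.
Proof.
move=> cA xM cx nU1; have [g gA gn] := exists_actM xM (subsetP sU1M _ nU1).
have gxM := act_notin gA xM.
have e1 : c (g x) - g x = c n - n.
  have e2 : g x = x + n + (g x - x - n) by abel.
  have := fixE cA gn; rewrite !(actE cA) cx => e3.
  have -> : c (g x) = x + c n + (g x - x - n) by rewrite -e3; abel.
  by abel.
have := stab_fix cA gxM; rewrite e1 => /(_ (U1disp cA nU1)) e2.
by apply/eqP; rewrite -subr_eq0 -e1 e2 subrr.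
Qed.

(* The centraliser of H / U1 fixes U1 pointwise: it is generated by two point
   stabilisers when these are nontrivial, and A is abelian of order p ^ 2 when
   they are trivial. *)
Let centraliser_fixU1_of_stab c x (z : {perm H}) n : c \in A -> x \notin M -> c x = x -> c != 1%g ->
  z \in A -> z x - x \in U1 -> n \in U1 -> z n = n.
Proof.
move=> cA xM cx c1 zA zx nU1.
have [m mM cm] : exists2 m, m \in M & c m != m.
  apply/exists_inP; apply: contraR c1 => /exists_inPn h; apply/eqP/permP => y.
  rewrite perm1; have [k yk] := hyperplane_span cardM y xM.
  have := h _ yk; rewrite negbK !(actE cA) actMn // cx => /eqP e.
  by apply: (addIr (- (x *+ k))).
have xmM : x + m \notin M by rewrite grpDr.
have iU1' : c m - m \in U1 by apply: Mdisp.
have iNU : c m - m \notin U.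
  apply: contra cm => cmU; have := stab_fix cA xmM; rewrite (actE cA) cx.
  have -> : x + c m - (x + m) = c m - m by abel.
  by move=> /(_ cmU) /addrI ->.
have zm : z (x + m) - (x + m) \in U1 by apply: (trivial_mod_U1 zA xM zx).
have [k zk] := span_prime p_pr sUU1 cardU1 iU1' iNU zm.
have ckA : (c ^+ k)%g \in A by apply: groupX.
have d0 : c (x + m) - (x + m) - (c m - m) \in U.
  by rewrite (actE cA) cx; have -> : x + c m - (x + m) - (c m - m) = 0 by [abel]; apply: grp0.
have h := actX_mod k iU cA d0 (U1disp cA iU1').
have ckVA := groupVr ckA.
have wA : (z * (c ^+ k)^-1)%g \in A by rewrite groupM.
have wx : (z * (c ^+ k)^-1)%g (x + m) = x + m.
  apply: stab_fix => //; rewrite permM.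
  have q : z (x + m) - (c ^+ k)%g (x + m) \in U.
    by inlin ((z (x + m) - (x + m) - (c m - m) *+ k) - ((c ^+ k)%g (x + m) - (x + m) - (c m - m) *+ k)).
  by have := @iU _ _ ckVA q; rewrite (actD _ _ ckVA) (actN _ ckVA) permK.
have wn := stab_fixU1 wA xmM wx nU1.
have cn := stab_fixU1 ckA xM (permX_fix k cx) nU1.
by rewrite -{2}cn -{2}wn permM permKV.
Qed.

(** [(a, u) |-> a x1 - x1 + u] embeds [A] times [U] in [M], so [A] has order at most [p ^ 2]. *)
Let abelian_of_semiregular :
  (forall c x, c \in A -> x \notin M -> c x = x -> c = 1%g) -> abelian A.
Proof.
move=> free; apply: (p2group_abelian pA).
pose g (t : {perm H} * H) := t.1 x1 - x1 + t.2.
have ginj : {in setX A U &, injective g}.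
  move=> [a u] [c v] /setXP[/= aA uU] /setXP[/= cA vU]; rewrite /g /= => e.
  have cVA := groupVr cA.
  have acU : a x1 - c x1 \in U.
    have -> : a x1 - c x1 = (a x1 - x1 + u) - (c x1 - x1 + v) - (u - v) by abel.
    by rewrite e subrr; inlin (- (u - v)).
  have ac : (a * c^-1)%g = 1%g.
    apply: (free _ x1) => //; first by rewrite groupM.
    apply: stab_fix => //; first by rewrite groupM.
    by have := @iU _ _ cVA acU; rewrite (actD _ _ cVA) (actN _ cVA) permK permM.
  have {}ac : a = c by apply/eqP; rewrite eq_mulgV1 ac.
  have -> : u = v by apply: (addrI (c x1 - x1)); rewrite -e ac.
  by rewrite ac.
have : (#|setX A U| <= #|M|)%N.
  rewrite -(card_in_imset ginj); apply: subset_leq_card.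
  apply/subsetP => _ /imsetP[[a u] /setXP[/= aA uU] ->]; rewrite /g /=.
  have q1 := hyperplane_act iM cardM x1 aA.
  have q2 := subsetP sU1M _ (subsetP sUU1 _ uU).
  exact: grpD.
have -> : #|M| = (p ^ 2 * #|U|)%N.
  by rewrite {1}(card_lg M) lgMU -addn2 addnC expnD -card_lg.
rewrite cardsX leq_pmul2r ?cardG_gt0 // {1}(card_pgroup pA).
by rewrite leq_exp2l ?prime_gt1.
Qed.

(** Let [a] move [x1] by [m] outside [U1]. Commuting with [a], [z] fixes [m] modulo [U], hence fixes
    [a m - m], which spans [U1] together with [U]. *)
Let centraliser_fixU1_of_abelian (z : {perm H}) n : abelian A ->
  z \in A -> z x1 - x1 \in U1 -> n \in U1 -> z n = n.
Proof.
move=> abA zA zx nU1.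
have comm a c y : a \in A -> c \in A -> c (a y) = a (c y).
  by move=> aA cA; rewrite -!permM (centsP abA _ aA _ cA).
have [a aA aU1] := exists_move x1M.
have mM := hyperplane_act iM cardM x1 aA.
have [m em] : exists m, m = a x1 - x1 by exists (a x1 - x1).
rewrite -em in aU1 mM.
have fixm (w : {perm H}) : w \in A -> w x1 - x1 \in U1 -> w m - m \in U.
  move=> wA wx; have := U1disp aA wx; rewrite !(actE aA) -(comm a w x1 aA wA) => h.
  by rewrite em !(actE wA); inlin (w (a x1) - a x1 - (w x1 - x1)).
have amU1 := Mdisp aA mM.
have amU : a m - m \notin U.
  apply: contra (aU1) => amU; apply/cenP => g gA.
  have gM := hyperplane_act iM cardM x1 gA.
  have [k gk] := span_prime p_pr sU1M cardMU1 mM aU1 gM.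
  have akA : (a ^+ k)%g \in A by apply: groupX.
  have akVA := groupVr akA.
  have d0 : a x1 - x1 - m \in U1 by rewrite -em subrr grp0.
  have h1 := actX_mod k iU1 aA d0 (Mdisp aA mM).
  have d1 : a m - m - 0 \in U by rewrite subr0.
  have d2 : a 0 - 0 \in U by rewrite act0 // subrr grp0.
  have h2 := actX_mod k iU aA d1 d2; rewrite mul0rn subr0 in h2.
  have wA : (g * (a ^+ k)^-1)%g \in A by rewrite groupM.
  have wx : (g * (a ^+ k)^-1)%g x1 - x1 \in U1.
    have q : g x1 - (a ^+ k)%g x1 \in U1.
      by inlin ((g x1 - x1 - m *+ k) - ((a ^+ k)%g x1 - x1 - m *+ k)).
    by have := @iU1 _ _ akVA q; rewrite (actD _ _ akVA) (actN _ akVA) permK permM.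
  have := @iU _ _ akA (fixm _ wA wx).
  rewrite (actD _ _ akA) (actN _ akA) permM permKV => h3.
  by inlin (g m - (a ^+ k)%g m + ((a ^+ k)%g m - m)).
have zm := fixm z zA zx.
have zn1 : z (a m - m) = a m - m.
  have := fixE aA zm; rewrite (actD _ _ aA) (actN _ aA) -(comm a z m aA zA) => e.
  have -> : z (a m - m) = (z (a m) - a m) + a m - z m by rewrite (actD _ _ zA) (actN _ zA); abel.
  by rewrite e; abel.
have [k nk] := span_prime p_pr sUU1 cardU1 amU1 amU nU1.
have := fixE zA nk; rewrite (actD _ _ zA) (actN _ zA) (actMn _ _ zA) zn1.
by move/addIr.
Qed.

Let centraliser_fixU1 (z : {perm H}) x n :
  z \in A -> x \notin M -> z x - x \in U1 -> n \in U1 -> z n = n.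
Proof.
move=> zA xM zx nU1.
have [/existsP[c /and3P[cA /existsP[y /andP[yM /eqP cy]] c1]]|free] :=
    boolP [exists c, [&& c \in A, [exists y, (y \notin M) && (c y == y)] & c != 1%g]].
  exact: centraliser_fixU1_of_stab cA yM cy c1 zA (trivial_mod_U1 zA xM zx y) nU1.
apply: centraliser_fixU1_of_abelian => //; last exact: (trivial_mod_U1 zA xM zx).
apply: abelian_of_semiregular => c y cA yM cy; apply/eqP; apply: contraR free => c1.
apply/existsP; exists c; rewrite cA c1 andbT /=; apply/existsP; exists y.
by rewrite yM cy eqxx.
Qed.

(** If [a] moved [x] off [x + U1], every [g] in [A] would be a power of [a] times an element
    centralising [H / U1]; both fix [n], so [n] would lie in [U]. *)
Let disp_of_fix a x n : a \in A -> x \notin M -> n \in U1 -> n \notin U -> a n = n ->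
  a x - x \in U1.
Proof.
move=> aA xM nU1 nU an; apply: contraR nU => aU1; apply/fixP => g gA.
have aM := hyperplane_act iM cardM x aA; have gM := hyperplane_act iM cardM x gA.
have [k gk] := span_prime p_pr sU1M cardMU1 aM aU1 gM.
have akA : (a ^+ k)%g \in A by apply: groupX.
have akVA := groupVr akA.
have d0 : a x - x - (a x - x) \in U1 by rewrite subrr grp0.
have h1 := actX_mod k iU1 aA d0 (Mdisp aA aM).
have wA : (g * (a ^+ k)^-1)%g \in A by rewrite groupM.
have wx : (g * (a ^+ k)^-1)%g x - x \in U1.
  have q : g x - (a ^+ k)%g x \in U1.
    by inlin ((g x - x - (a x - x) *+ k) - ((a ^+ k)%g x - x - (a x - x) *+ k)).
  by have := @iU1 _ _ akVA q; rewrite (actD _ _ akVA) (actN _ akVA) permK permM.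
have wn := centraliser_fixU1 wA xM wx nU1.
by rewrite -[RHS](permX_fix k an) -{2}wn permM permKV.
Qed.

(** As [f] is additive along [n] in [U1], the elements induced at [x] and at [x + n] agree at [x]
    and at [n], which forces [a n = n]; [disp_of_fix] then applies. *)
Let outside_addmod x : x \notin M -> x \in addmod U1.
Proof.
move=> xM; apply/addmodP => y; have [a aA ea] := fA x y.
have fixU1 n : n \in U1 -> a n = n.
  move=> nU1; have [c cA ec] := fA (x + n) y.
  have /addsetP nK := U1_additive nU1.
  have e1 : c (x + n) = a x + n.
    apply: (@perm_inj _ f); apply: (addrI (f y)).
    by rewrite -ec addrAC !nK ea addrA.
  have cVA := groupVr cA.
  have vU := U1disp cA nU1.
  have e2 : a x = c x + (c n - n) by apply: (addIr n); rewrite -e1 (actE cA); abel.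
  have dA : (a * c^-1)%g \in A by rewrite groupM.
  have dx : (a * c^-1)%g x = x.
    apply: stab_fix => //; rewrite permM e2 (actD _ _ cVA) permK (fixE cVA vU).
    by inlin (c n - n).
  have dn := stab_fixU1 dA xM dx nU1.
  have ac : a n = c n by rewrite -{2}dn permM permKV.
  have axc : a x = c x by rewrite -{2}dx permM permKV.
  rewrite ac; apply/eqP; rewrite -subr_eq0; apply/eqP; apply: (addrI (c x)).
  by rewrite -e2 addr0.
have h := disp_of_fix aA xM a1U1 a1U (fixU1 _ a1U1).
have -> : f (y + x) - f y - f x = f (a x) - f x by rewrite [y + x]addrC ea; abel.
by rewrite im_sub.
Qed.

(* [diff2 x y] takes its values in [f @: n] for the [n] in U1 with [x + n] in the
   basic set of [x]. *)
Let diff2_shift x y v : x \notin M -> exists n,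
  [/\ n \in U1, diff2 x y v = f n & exists2 w, w \in A & w x = x + n].
Proof.
move=> xM; have /addmodP xK := outside_addmod xM; pose F1 := im_group iU1.
have [a aA ea] := fA x (v + y); have [c cA ec] := fA x v.
have q g z : g \in A -> f (x + z) = f z + f (g x) -> g x - x \in U1.
  move=> gA e; rewrite -(im_sub _ _ iU1).
  by have := xK z; rewrite [z + x]addrC e [f z + _]addrC addrK.
have ax := q _ _ aA ea; have cx := q _ _ cA ec.
have nU1 : a x - c x \in U1 by inlin ((a x - x) - (c x - x)).
exists (a x - c x); split=> //.
  have /addsetP nK := U1_additive nU1.
  have e1 : f (a x) = f (c x) + f (a x - c x).
    by rewrite -nK; congr (f _); abel.
  have -> : diff2 x y v = f (a x) - f (c x).
    by rewrite /diff2 [v + y + x]addrC ea [v + x]addrC ec; abel.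
  by rewrite e1; abel.
have cVA := groupVr cA.
exists (a * c^-1)%g; first by rewrite groupM.
have := centraliser_fixU1 cA xM cx nU1 => cn.
have e2 : (c^-1)%g (a x - c x) = a x - c x by rewrite -{1}cn permK.
by rewrite permM; move: e2; rewrite (actD _ _ cVA) (actN _ cVA) permK => <-; abel.
Qed.

(** Symmetry of the second difference yields one [n] with [x + n] in the orbit of [x] and [a x + n]
    in that of [a x]. Conjugating back by [a] shows [a n = n]; so [n] is in [U] by [disp_of_fix],
    hence in [W x], which is trivial. *)
Let diff2_moved x a v : x \notin M -> a \in A -> a x - x \notin U1 ->
  diff2 x (a x) v = 0.
Proof.
move=> xM aA axU1; have axM := act_notin aA xM.
have [n [nU1 en [w wA wx]]] := diff2_shift (a x) v xM.
have [n' [_ en' [w' w'A w'x]]] := diff2_shift x v axM.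
have {en'} nn' : n' = n by apply: (@perm_inj _ f); rewrite -en -en' diff2C.
rewrite {n'}nn' in w'x.
have aVA := groupVr aA; have wVA := groupVr wA.
have gU : (a^-1)%g n - n \in U by apply: U1disp.
pose g := (a * w' * a^-1)%g.
have gA : g \in A by rewrite !groupM.
have gx : g x = x + (a^-1)%g n by rewrite /g !permM w'x (actD _ _ aVA) permK.
have wgx : (g * w^-1)%g x = x + ((a^-1)%g n - n).
  rewrite permM gx; have -> : x + (a^-1)%g n = w x + ((a^-1)%g n - n) by rewrite wx; abel.
  by rewrite (actD _ _ wVA) permK (fixE wVA gU).
have an : a n = n.
  have : (g * w^-1)%g x = x.
    apply: stab_fix => //; first by rewrite groupM.
    by rewrite wgx; inlin ((a^-1)%g n - n).
  rewrite wgx => e; have {}e : (a^-1)%g n - n = 0 by apply: (addrI x); rewrite e addr0.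
  by move/eqP: e; rewrite subr_eq0 => /eqP e; rewrite -{1}e permKV.
have nU : n \in U by apply: contraNT axU1 => nU; apply: disp_of_fix nU1 nU an.
suff n0 : n = 0 by rewrite en n0 f0.
by apply: (fixrad0 xM); apply/fixradP; split=> //; exists w.
Qed.

(** For [x] outside [M], the [y] with vanishing second difference along [x] form a group containing
    [U1], [a x] and, as [p] is odd, [a (a x)]. Since [a (a x) - a x] is congruent to [a x - x]
    modulo [U1], it contains [x] and [M]. *)
Lemma additive_of_transitive x : x \in addset.
Proof.
have outK : forall x, x \notin M -> x \in addset.
  move=> {}x xM; pose S : {set H} := [set y | [forall v, diff2 x y v == 0]].
  have SP y : reflect (forall v, diff2 x y v = 0) (y \in S).
    by rewrite inE; apply: (iffP forallP) => h v; apply/eqP; apply: h.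
  have gS : group_set S.
    apply: add_group_set => [|y y' /SP yS /SP y'S]; apply/SP => v.
      by rewrite /diff2 !addr0; abel.
    have -> : diff2 x (y + y') v = diff2 x y (v + y') + diff2 x y' v.
      rewrite /diff2; have -> : v + (y + y') = v + y' + y by abel.
      by abel.
    by rewrite yS y'S addr0.
  pose G := Group gS.
  have sU1G : U1 \subset G.
    apply/subsetP => n /U1_additive/addsetP nK; apply/SP => v.
    by rewrite diff2C /diff2 !nK; abel.
  have [a aA aU1] := exists_move xM.
  have dM := hyperplane_act iM cardM x aA.
  have adU1 := Mdisp aA dM.
  have y1G : a x \in G by apply/SP => v; apply: diff2_moved.
  have y2G : (a * a)%g x \in G.
    apply/SP => v; apply: (@diff2_moved x (a * a)%g) => //; first exact: groupM.
    apply: contra (aU1) => h; apply: (grp_half p_pr expH p_odd).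
    rewrite permM in h; rewrite (actD _ _ aA) (actN _ aA) in adU1.
    by inlin (a (a x) - x - (a (a x) - a x - (a x - x))).
  have dG : a x - x \in G.
    have := subsetP sU1G _ adU1; rewrite permM in y2G; rewrite (actD _ _ aA) (actN _ aA) => h.
    inlin (a (a x) - a x - (a (a x) - a x - (a x - x))).
  have xG : x \in G by inlin (a x - (a x - x)).
  have sMG : M \subset G.
    apply/subsetP => m mM; have [k mk] := span_prime p_pr sU1M cardMU1 dM aU1 mM.
    have mk' := subsetP sU1G _ mk; inlin (m - (a x - x) *+ k + (a x - x) *+ k).
  have allG := hyperplane_full cardM sMG xG xM.
  apply/addsetP => v; have /SP/(_ 0) := allG v.
  rewrite /diff2 !add0r f0 addr0 => /eqP; rewrite -addrA -opprD subr_eq0 => /eqP ->.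
  by rewrite addrC.
have [xM|] := boolP (x \in M); last exact: outK.
have x1K := outK _ x1M.
have xx1 : x + x1 \notin M by apply: contra x1M => h; inlin (x + x1 - x).
have := outK _ xx1 => h; have h1 : x1 \in addset_group by [].
have h2 : x + x1 \in addset_group by [].
suff : x \in addset_group by [].
inlin (x + x1 - x1).
Qed.

End Transitive.
End NoncentralQuotient.

(** * Existence of an additive representative *)

Lemma cen_lg E : invariant E -> (lg E < lg [set: H]%G)%N -> (lg E < lg (cen_group E))%N.
Proof.
move=> iE ltE; have [k cH] : exists k, #|H| = (p ^ k)%N.
  by exists (lg [set: H]%G); rewrite -cardsT -card_lg.
have neE : E != [set: H] :> {set H}.
  by apply: contraTneq ltE => ->; rewrite ltnn.
have [x xc xE] := cen_proper cH iE neE.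
apply: lg_proper; rewrite properE sub_cen //; apply: contra xE => /subsetP; exact.
Qed.

Lemma full_of_lg E x : (lg [set: H]%G <= lg E)%N -> x \in E.
Proof.
move=> h; have -> : E = [set: H]%G; last by rewrite inE.
apply/val_inj/eqP; rewrite /= eqEcard subsetT (card_lg E) (card_lg [set: H]%G).
by rewrite leq_exp2l ?prime_gt1.
Qed.

Hypotheses (lgH : lg [set: H]%G = 5%N) (lgU : (2 <= lg U)%N).

(** The chain [U], [cen U], [cen (cen U)] grows strictly until it reaches [H], of order [p ^ 5]. As
    [U] has order at least [p ^ 2], only the cases of the overview and [cen U = H] remain. *)
Lemma addmod_total x : x \in addmod U.
Proof.
have iU := fix_invariant; have iU1 := cen_invariant iU; have iM := cen_invariant iU1.
have [U15|ltU1] := leqP 5 (lg (cen_group U)).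
  by apply: (subsetP (cen_addmod iU)); apply: full_of_lg; rewrite lgH.
have UU1 : (lg U < lg (cen_group U))%N.
  by apply: cen_lg => //; rewrite lgH (leq_ltn_trans (lg_sub (sub_cen iU))).
have [U14|U1n4] := eqVneq (lg (cen_group U)) 4%N.
  apply: addmod_of_hyperplane; first by apply: lg_prime_index; rewrite lgH U14.
  by rewrite U14 addn2 !ltnS.
have U13 : lg (cen_group U) = 3%N.
  apply/eqP; rewrite eqn_leq (leq_ltn_trans lgU UU1) andbT.
  by rewrite -ltnS ltn_neqAle U1n4 -ltnS.
have U2 : lg U = 2%N by apply/eqP; rewrite eqn_leq lgU andbT -ltnS -U13.
have cardU1 : #|cen_group U| = (p * #|U|)%N by apply: lg_prime_index; rewrite U13 U2.
have [M5|ltM] := leqP 5 (lg (cen_group (cen_group U))).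
  have [e eU1 eU] : exists2 e, e \in cen_group U & e \notin U.
    by apply/subsetPn; apply: contraTN UU1 => /lg_sub; rewrite -leqNgt.
  apply: (addmod_of_central_quotient U2 U13 lgH _ eU1 eU) => a y aA.
  by apply: cen_disp => //; apply: full_of_lg; rewrite lgH.
have M4 : lg (cen_group (cen_group U)) = 4%N.
  apply/eqP; rewrite eqn_leq -ltnS ltM -{1}U13 cen_lg //.
  by rewrite lgH U13.
have cardM : #|[set: H]%G| = (p * #|cen_group (cen_group U)|)%N.
  by apply: lg_prime_index; rewrite lgH M4.
have cardMU1 : #|cen_group (cen_group U)| = (p * #|cen_group U|)%N.
  by apply: lg_prime_index; rewrite M4 U13.
pose moves (a : {perm H}) y :=
  [&& a \in A, y \notin cen (cen U), a y - y \in cen U & a y - y \notin U].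
have [/existsP[a /existsP[y /and4P[aA yM ayU1 ayU]]]|nomove] :=
    boolP [exists a, [exists y, moves a y]].
  apply/addmodP => z.
  have lgMU : lg (cen_group (cen_group U)) = (lg U).+2 by rewrite M4 U2.
  have /addsetP -> := additive_of_transitive cardM cardU1 cardMU1 lgMU yM aA ayU1 ayU x.
  have -> : f z + f x - f z - f x = 0 by abel.
  exact: (grp0 (im_group iU)).
apply: (addmod_of_semiregular cardM) => a y aA yM ayU1; apply: contraR nomove => ayU.
by apply/existsP; exists a; apply/existsP; exists y; apply/and4P.
Qed.

(** If [U] has order [p ^ 4], it is a hyperplane on whose cosets [W] is constant; so [W] is trivial
    outside [U], and [f] is additive. *)
Lemma diff2_const x z y : diff2 x z y = diff2 x z 0.
Proof.
have [U3|U4] := leqP (lg U) 3; first exact: (addmod_affine U3 addmod_total).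
suff xK : x \in addset by have /addsetP xK' := xK; rewrite /diff2 !xK'; abel.
have [U5|ltU] := leqP 5 (lg U).
  by apply: (subsetP fix_addset); apply: full_of_lg; rewrite lgH.
have cardU : #|[set: H]%G| = (p * #|U|)%N.
  by apply: lg_prime_index; rewrite lgH; congr S; apply/eqP; rewrite eqn_leq U4 /= -ltnS.
apply: (hyperplane_additive cardU); last exact: addmod_total.
move=> w wU u uW.
apply: (hyperplane_fixrad fix_invariant cardU wU (subsetP (fixrad_sub w) _ uW)).
by move=> m mU; rewrite fixrad_addU.
Qed.

Lemma exists_linear_representative :
  exists2 L : {perm H}, L \in AutH H & forall x, exists2 a, a \in A & L x = f (a x).
Proof. exact: additive_representative addmod_total diff2_const. Qed.

End Isomorphism.
End Indecomposable.
End Action.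

(** * Isomorphisms of orbit S-rings *)

Section CayleyIsomorphisms.
Variable H : finZmodType.
Implicit Types (A : {group {perm H}}) (s f : {perm H}).

Lemma autH0 s : s \in AutH H -> s 0 = 0.
Proof. by move/autHP => sD; apply: (addrI (s 0)); rewrite -sD !addr0. Qed.

Lemma autHN s x : s \in AutH H -> s (- x) = - s x.
Proof.
by move=> sH; apply: (addrI (s x)); rewrite -(autHP _ sH) !subrr autH0.
Qed.

Lemma autHV s : s \in AutH H -> (s^-1)%g \in AutH H.
Proof.
move/autHP => sD; apply/autHP => x y; apply: (@perm_inj _ s).
by rewrite sD !permKV.
Qed.

Lemma autHM s t : s \in AutH H -> t \in AutH H -> (s * t)%g \in AutH H.
Proof. by move=> /autHP sD /autHP tD; apply/autHP => x y; rewrite !permM sD tD. Qed.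

Lemma VorbP A T : reflect (exists x, T = Defs.orbA A x) (T \in Vorb A).
Proof. by apply: (iffP imsetP) => [[x _ ->]|[x ->]]; exists x. Qed.

Lemma Vorb_partition A : partition (Vorb A) [set: H].
Proof.
have -> : Vorb A = orbit 'P A @: [set: H].
  by apply/setP => T; apply/imsetP/imsetP => [[x _ ->]|[x _ ->]]; exists x.
by apply: orbit_partition; apply/actsP => a aA x; rewrite !inE.
Qed.

Lemma mulcoef_act A a T1 T2 x : A \subset AutH H -> a \in A ->
  T1 \in Vorb A -> T2 \in Vorb A -> (mulcoef T1 T2 x <= mulcoef T1 T2 (a x))%N.
Proof.
move=> autA aA /VorbP[x1 ->] /VorbP[x2 ->].
have /autHP aD := subsetP autA _ aA.
pose g (t : H * H) := (a t.1, a t.2).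
have ginj : injective g by move=> [u v] [u' v'] [/perm_inj-> /perm_inj->].
rewrite /mulcoef -(card_imset _ ginj); apply: subset_leq_card.
apply/subsetP => _ /imsetP[[u v] /[!inE] /= /and3P[uT vT /eqP <-] ->] /=.
have orb z w : w \in Defs.orbA A z -> a w \in Defs.orbA A z.
  move=> /basic_setP[c cA ->]; apply/basic_setP; exists (c * a)%g; rewrite ?groupM //.
  by rewrite permM.
by rewrite !orb //= aD.
Qed.

Lemma Vorb_Sring A : A \subset AutH H -> is_Sring (Vorb A).
Proof.
move=> autA; split; first exact: Vorb_partition.
- apply/VorbP; exists 0; apply/setP => y; rewrite inE; apply/eqP/basic_setP => [->|[a aA ->]].
    by exists 1%g; rewrite ?perm1 ?group1.
  by rewrite autH0 // (subsetP autA).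
- move=> _ /VorbP[x ->]; apply/VorbP; exists (- x); apply/setP => y.
  apply/imsetP/basic_setP => [[_ /basic_setP[a aA ->] ->]|[a aA ->]].
    by exists a; rewrite ?autHN ?(subsetP autA).
  exists (a x); last by rewrite autHN ?(subsetP autA).
  by apply/basic_setP; exists a.
move=> T1 T2 _ T1P T2P /VorbP[z ->] x y /basic_setP[a aA ->] /basic_setP[c cA ->].
have key a1 c1 : a1 \in A -> c1 \in A -> (mulcoef T1 T2 (a1 z) <= mulcoef T1 T2 (c1 z))%N.
  move=> a1A c1A; have -> : c1 z = (a1^-1 * c1)%g (a1 z) by rewrite permM permK.
  by apply: (mulcoef_act (A := A)); rewrite ?groupM ?groupV.
by apply/eqP; rewrite eqn_leq !key.
Qed.

Lemma dimgM s t (D : {set H * H}) : dimg (s * t)%g D = dimg t (dimg s D).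
Proof.
by rewrite /dimg -imset_comp; apply: eq_imset => u; rewrite /= !permM.
Qed.

Lemma dimg_inj s : injective (fun u : H * H => (s u.1, s u.2)).
Proof. by move=> [u v] [u' v'] [/perm_inj-> /perm_inj->]. Qed.

Lemma dimg_cay s (T : {set H}) : s \in AutH H -> dimg s (cay T) = cay (s @: T).
Proof.
move=> sH; apply/setP => [[u v]]; rewrite inE /=; apply/imsetP/imsetP.
  case=> [[u' v']]; rewrite inE /= => h [-> ->]; exists (v' - u') => //.
  by rewrite (autHP _ sH) autHN.
case=> t tT e; exists ((s^-1)%g u, (s^-1)%g v); last by rewrite /= !permKV.
have sVH := autHV sH; rewrite inE /= -autHN // -(autHP _ sVH) e permK.
by [].
Qed.

Lemma Vorb_conj A s : [set s @: (T : {set H}) | T in Vorb A] = Vorb (A :^ s)%g.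
Proof.
have img x : s @: Defs.orbA A x = Defs.orbA (A :^ s)%g (s x).
  apply/setP => y; apply/imsetP/imsetP => [[_ /basic_setP[a aA ->] ->]|[_ /imsetP[a aA ->] ->]].
    by exists (a ^ s)%g; rewrite ?memJ_conjg // conjgE !permM permK.
  exists (a x); first by apply/basic_setP; exists a.
  by rewrite conjgE !permM permK.
apply/setP => T; apply/imsetP/imsetP => [[_ /VorbP[x ->] ->]|[x _ ->]].
  by exists (s x).
exists (Defs.orbA A ((s^-1)%g x)); first by apply/VorbP; exists ((s^-1)%g x).
by rewrite img permKV.
Qed.

Lemma IsoS_of_product A f : A \subset AutH H ->
  f \in (AutS (Vorb A) * AutH H)%g -> IsoS (Vorb A) f.
Proof.
move=> autA /mulsgP[a s aS sH ->]; exists (Vorb (A :^ s)%g); split.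
  apply: (@Vorb_Sring (A :^ s)%G); apply/subsetP => _ /imsetP[c cA ->].
  by rewrite conjgE !autHM ?autHV // (subsetP autA).
have dimgT T : T \in Vorb A -> dimg (a * s)%g (cay T) = cay (s @: T).
  move=> TP; move: aS; rewrite inE => /forall_inP/(_ T TP)/eqP aT.
  by rewrite dimgM aT dimg_cay.
rewrite -Vorb_conj; apply/setP => D; apply/imsetP/imsetP => [[T TP ->]|[_ /imsetP[T TP ->] ->]].
  by exists (s @: T); [apply: imset_f|rewrite dimgT].
by exists T; rewrite ?dimgT.
Qed.

(** The image of [cay T] is some [cay S], whose arcs depend only on differences; so the arc leaving
    [f y] can be translated to leave [f 0]. *)
Lemma IsoS_disp A f x y : IsoS (Vorb A) f ->
  exists2 a, a \in A & f (x + y) - f y = f (a x) - f 0.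
Proof.
case=> Q [_ eQ]; pose T := Defs.orbA A x.
have : dimg f (cay T) \in [set dimg f (cay T) | T in Vorb A].
  by apply: imset_f; apply/VorbP; exists x.
rewrite eQ => /imsetP[S _ eS].
have xT : x \in T := mem_basic_set A x.
have : (f y, f (x + y)) \in cay S.
  by rewrite -eS; apply/imsetP; exists (y, x + y); rewrite // inE /= addrK.
rewrite inE /= => sS.
have : (f 0, f 0 + (f (x + y) - f y)) \in cay S by rewrite inE /= addrC addKr.
rewrite -eS => /imsetP[[u v]]; rewrite inE /= => uvT [/perm_inj e1 e2].
have /basic_setP[a aA e3] : v \in T by rewrite -[v]subr0 e1.
by exists a; rewrite // -e3 -e2; abel.
Qed.

(** By counting, [L] maps each orbit onto the values of [f x - f 0] there. So [f v - f u] lies in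
    the [L]-image of the orbit of [v - u], and [f] followed by the inverse of [L] preserves every
    [cay T]. *)
Lemma product_of_representative A f (L : {perm H}) : A \subset AutH H ->
  (forall x y, exists2 a, a \in A & f (x + y) - f y = f (a x) - f 0) ->
  L \in AutH H -> (forall x, exists2 a, a \in A & L x = f (a x) - f 0) ->
  f \in (AutS (Vorb A) * AutH H)%g.
Proof.
move=> autA fA LH LA.
have LfA w : exists2 a, a \in A & f w - f 0 = L (a w).
  have eqO : L @: Defs.orbA A w = [set f x - f 0 | x in Defs.orbA A w].
    apply/eqP; rewrite eqEcard; apply/andP; split.
      apply/subsetP => _ /imsetP[z zw ->]; have [a aA ->] := LA z.
      apply: imset_f; case/basic_setP: zw => c cA ->; apply/basic_setP.
      by exists (c * a)%g; rewrite ?groupM // permM.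
    have finj : injective (fun x => f x - f 0) by move=> u v /addIr/perm_inj.
    by rewrite (card_imset _ finj) (card_imset _ (@perm_inj _ L)) leqnn.
  have : f w - f 0 \in L @: Defs.orbA A w.
    rewrite eqO; apply/imsetP; exists w => //; exact: mem_basic_set.
  by case/imsetP => _ /basic_setP[a aA ->] ->; exists a.
have LVH := autHV LH.
apply/mulsgP; exists (f * L^-1)%g L => //; last by rewrite mulgKV.
rewrite inE; apply/forall_inP => _ /VorbP[z ->].
rewrite eqEcard; apply/andP; split.
  apply/subsetP => _ /imsetP[[u v] uv ->]; move: uv; rewrite !inE /= !permM.
  rewrite -autHN // -(autHP _ LVH) => /basic_setP[g gA e].
  have [a aA] := fA (v - u) u; rewrite subrK => ->; have [c cA ->] := LfA (a (v - u)).
  rewrite permK e; apply/basic_setP; exists (g * a * c)%g; first by rewrite !groupM.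
  by rewrite !permM.
by rewrite card_imset //; apply: dimg_inj.
Qed.

End CayleyIsomorphisms.

Theorem theorem6p1 (p : nat) (pr_p : prime p) (odd_p : odd p)
  (A : {group {perm 'rV['Z_p]_5}})
  (hA : A \subset AutH 'rV['Z_p]_5)
  (pA : (p.-group A)%g)
  (hC : (p ^ 2 <= #|CH A|)%N)
  (hind : ~~ decomposable (Vorb A)) :
  CI_Sring (Vorb A).
Proof.
pose H : finZmodType := 'rV['Z_p]_5.
have p_gt1 := prime_gt1 pr_p.
have expH (x : H) : x *+ p = 0.
  apply/rowP => i; rewrite mulmxnE mxE -mulr_natr.
  by rewrite -[p%:R]/((p)%:R : 'Z_p) pchar_Zp // mulr0.
have cardH : #|[set: H]| = (p ^ 5)%N.
  by rewrite cardsT card_mx card_ord Zp_cast // mul1n.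
have pH : (p.-group [set: H])%g by rewrite /pgroup cardH pnatX pnat_id.
have lgH : logn p #|[set: H]| = 5%N by rewrite cardH pfactorK.
have lgU : (2 <= logn p #|CH A|)%N.
  by rewrite -(leq_exp2l _ _ p_gt1) -(card_lg pH (fix_group hA)).
move=> f; split; last exact: IsoS_of_product.
move=> isof; have fA x y := IsoS_disp x y isof.
(* A translation after [f] normalises it to fix [0]. *)
pose g x := f x - f 0.
have ginj : injective g by move=> x y /addIr/perm_inj.
have g0 : perm ginj 0 = 0 by rewrite permE /g subrr.
have gA x y : exists2 a, a \in A & perm ginj (x + y) = perm ginj y + perm ginj (a x).
  have [a aA e] := fA x y; exists a => //; rewrite !permE /g -e; abel.
have [L LH LA] := @exists_linear_representative _ _ _ pr_p odd_p expH hA pA hind _ g0 gA pH lgH lgU.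
apply: product_of_representative LH _ => // x.
by have [a aA e] := LA x; exists a; rewrite // e permE.
Qed.
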